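(* If the PDMP conditions, the structural conditions and the model conditions of the context are satisfied, then $$\inf_{\hat\lambda_n}\ \sup_{\lambda\in\mathcal E(\mathfrak s,b,\alpha)}\mathbb E_{z_0}\left(\|\hat\lambda_n-\lambda\|_{L^2(\mathcal I)}^2\right)\ge C\,n^{-2\alpha/(2\alpha+1)}$$ for a positive constant $C$ (not depending on $n$), where the infimum is taken among all estimators $\hat\lambda_n$ of $\lambda$ (based on the observations $(Z_0,Y_1,Z_1,\dots,Y_n,Z_n)$).
   Context: Notation: $\mathbb R^+=[0,\infty)$; $\mathcal I=[i_1,i_2]\subset(0,\infty)$ is a fixed compact interval. PDMP conditions. A piecewise deterministic Markov process (PDMP) on $\mathbb R^+$ has a flow $\phi$, a jump rate $\lambda$ and a transition measure $Q$. (i) $\phi:\mathbb R^+\times\mathbb R^+\to\mathbb R^+$ is a one-parameter group of homeomorphisms: $\phi$ is $C^1$, for each $t\in\mathbb R^+$, $\phi(\cdot,t)$ is a homeomorphism satisfying the semigroup property $\phi(\cdot,t+s)=\phi(\phi(\cdot,s),t)$, and for each $x\in\mathbb R^+$, $\phi_x:=\phi(x,\cdot)$ is an increasing $C^1$-diffeomorphism (so $\phi(x,0)=x$). (ii) $\lambda:\mathbb R^+\to\mathbb R^+$ is measurable and for every $x\in\mathbb R^+$ there is $\varepsilon'>0$ with $\int_0^{\varepsilon'}\lambda(\phi(x,s))ds<\infty$. (iii) $Q(x,\mathbb R^+\setminus\{x\})=1$ for all $x\in\mathbb R^+$. Jump chain. Start from a fixed $Z_0=z_0$. Given $Z_{k-1}=z$,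 the pre-jump location $Y_k$ satisfies $P(Y_k>y\mid Z_{k-1}=z)=\exp(-\int_z^y\lambda(u)(\phi_z^{-1})'(u)du)$ for $y\ge z$; given $Y_k=y$, the post-jump location $Z_k$ has law $Q(y,\cdot)$; $(Z_0,Y_1,Z_1,Y_2,Z_2,\dots)$ is Markov. $\mathbb E_{z_0}$ is taken given $Z_0=z_0$ under the jump rate $\lambda$. Hölder spaces. With $r=\lfloor\beta\rfloor$, $H^\beta(A)$ is the set of $f\in C^r(A)$ with finite $|f|_{H^\beta(A)}=\sup_{t>0}t^{r-\beta}\omega(f^{(r)},t)_\infty$, where $\omega(g,t)_\infty=\sup_{|x-y|\le t}|g(x)-g(y)|$, and $\|f\|_{H^\beta(A)}=|f|_{H^\beta(A)}+\|f\|_{L^\infty(A)}$. Structural conditions. (S1) There is $\kappa<1$ with $P(Z_1\le\kappa Y_1)=1$. (S2) There are functions $\mathbf m,\mathbf M$ with $0<\mathbf m(y)\le(\phi_x^{-1})'(y)\le\mathbf M(y)$ for all $(x,y)\in(\mathbb R^+)^2$. (S3) $\lambda$ is positive on $[i_1,\infty)$ and there are $\mathbf a>0$, $b>-1$ with $\lambda(y)\mathbf m(y)\ge\mathbf a\frac{y^b}{b+1}$ for all $y\ge i_1$. (S4) There are positive constants $\mathbf L,\mathbf l$ with $\|\lambda\|_{L^\infty([i_1,i_2'])}\le\mathbf L$ and $\int_0^{i_1}\lambda(u)\mathbf M(u)du\le\mathbf l$, where $i_2'=\max\Big(i_2,(i_2-i_1)+\big(\tfrac1{\mathbf a(1-\kappa^{b+1})}\ln\tfrac{2\kappa^{b+1}}{1-\kappa^{b+1}}\big)^{1/(b+1)}\mathbf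 1_{\{\kappa^{b+1}\ge1/3\}}\Big)$. (S5) $\lambda(y)<\infty$ for all $y\in\mathbb R^+$. (S6) There is $\alpha>0$ such that: for every compact $K\subset(0,\infty)$ and $z>0$, $(x,y)\mapsto(\phi_x^{-1})'(y)$ belongs to $H^\alpha([0,z]\times K)$; $\lambda\in H^\alpha(K)$ for every compact $K\subset(0,\infty)$; and $Q(x,dy)=Q_1(x,y)dy+p_0(x)\delta_0(dy)+\sum_{i=1}^{j_Q}p_i(x)\delta_{f_i(x)}(dy)$ where, for any compact $K$, $Q_1$ and $(p_i)_{0\le i\le j_Q}$ are in $H^{\alpha-1}(K)$, and $(f_i)_{1\le i\le j_Q}$ are invertible functions with $f_i^{-1}\in H^\alpha(K)$. Class of jump rates. Set $\mathcal J_0=\mathcal I$, $\mathcal J_{k+1}=\mathrm{Conv}(\mathcal I\cup\bigcup_{i=1}^{j_Q}f_i^{-1}(\mathcal J_k))$, $\mathcal J=\mathcal J_{\lfloor\alpha\rfloor}\cup[i_1,i_2']=[j_1,j_2]$. For fixed $\phi,Q$ and $\mathfrak s=(\mathbf a,\mathbf l,\mathbf L)\in(\mathbb R^+)^3$, $\mathcal E(\mathfrak s,b,\alpha)$ is the set of $\lambda\in H^\alpha(\mathcal J)$ with $\lambda(y)\mathbf m(y)\ge\frac{\mathbf a y^b}{b+1}$ for all $y\ge i_1$, $\int_0^{i_1}\lambda(u)\mathbf M(u)du\le\mathbf l$, and $\|\lambda\|_{H^\alpha(\mathcal J)}\le\mathbf L$. Model conditions. $(S_m)_{m\in\mathbb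 N}$ are linear subspaces of $L^2(\mathcal I)$ such that: (1) $S_m$ is increasing in $m$ and has finite dimension $D_m$; (2) there is $\psi_1>0$ with $\|s\|_\infty^2\le\psi_1D_m\|s\|_{L^2}^2$ for all $m$, $s\in S_m$; (3) there is $\psi_2>0$ such that each $S_m$ has an orthonormal basis $(\varphi_l)_{1\le l\le D_m}$ with $\|\sum_l\|\varphi_l\|_\infty|\varphi_l|\|_\infty\le\psi_2D_m$; (4) there are $\mathbf r\in\mathbb N$, $C'>0$ such that for all $\beta\le\mathbf r$ and $s\in B^\beta_{2,\infty}$, the orthogonal projection $s_m$ of $s$ on $S_m$ satisfies $\|s-s_m\|_{L^2}\le C'D_m^{-\beta}\|s\|_{B^\beta_{2,\infty}}$. Here $\|f\|_{B^\beta_{2,\infty}}=\|f\|_{L^2}+\sup_{t>0}t^{-\beta}\omega_{r+1}(f,t)_2$, $r=\lfloor\beta\rfloor$, $\omega_r(f,t)_2=\sup_{0<h\le t}\|\sum_{k=0}^r(-1)^k\binom rk f(\cdot+kh)\|_{L^2}$, and $B^\beta_{2,\infty}$ is the set of $f\in L^2$ with finite norm. (The family $(S_m)$ does not appear in the conclusion.)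
   Formalization: Added hypothesis: the class E(s,b,α) contains a jump rate whose H^α(J) norm is strictly below L. Without it the claim can fail: with φ(x,t)=x+t, m=M=1, b=0 and a=L, every rate of the class equals L on I, so the risk can be zero. *)

(* Defs.v *)
From HB Require Import structures.
From mathcomp Require Import all_boot all_order all_algebra.
From mathcomp Require Import all_classical all_reals all_analysis.

Set Implicit Arguments.
Unset Strict Implicit.
Unset Printing Implicit Defensive.

Import Order.TTheory GRing.Theory Num.Theory.
Import numFieldNormedType.Exports.

Local Open Scope classical_set_scope.
Local Open Scope ring_scope.

Definition Rplus (R : realType) : set R := [set x | 0 <= x].
Arguments Rplus {R}.

Definition Rpos (R : realType) : set R := [set x | 0 < x].
Arguments Rpos {R}.

(** * Derivatives relative to a set

    Every set [A] below is a non-degenerate interval; at an endpoint of [A]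
    belonging to [A], the derivative relative to [A] is the one-sided one. *)

Definition slope_at (R : realType) (f : R -> R) (x y : R) : R :=
  (f y - f x) / (y - x).

Definition derivable_in (R : realType) (A : set R) (f : R -> R) (x : R) : Prop :=
  cvg (slope_at f x y @[y --> within A x^']).

Definition deriv_in (R : realType) (A : set R) (f : R -> R) (x : R) : R :=
  lim (slope_at f x y @[y --> within A x^']).

Definition derivn_in (R : realType) (A : set R) (k : nat) (f : R -> R) : R -> R :=
  iter k (deriv_in A) f.

(* C^r(A) *)
Definition Cr (R : realType) (A : set R) (r : nat) (f : R -> R) : Prop :=
  (forall k, (k < r)%N -> forall x, A x -> derivable_in A (derivn_in A k f) x) /\
  {within A, continuous (derivn_in A r f)}.

Definition pderiv1 (R : realType) (A : set R) (f : R * R -> R) : R * R -> R :=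
  fun p => deriv_in A (fun u => f (u, p.2)) p.1.

Definition pderiv2 (R : realType) (B : set R) (f : R * R -> R) : R * R -> R :=
  fun p => deriv_in B (fun v => f (p.1, v)) p.2.

Definition pderivn (R : realType) (A B : set R) (i j : nat) (f : R * R -> R) :
    R * R -> R :=
  iter i (pderiv1 A) (iter j (pderiv2 B) f).

(* C^r(A x B). By Schwarz' theorem it is enough to take the derivatives in the
   second variable first. *)
Definition Cr2 (R : realType) (A B : set R) (r : nat) (f : R * R -> R) : Prop :=
  [/\ forall j, (j < r)%N -> forall x y, A x -> B y ->
        derivable_in B (fun v => pderivn A B 0 j f (x, v)) y,
      forall i j, (i + j < r)%N -> forall x y, A x -> B y ->
        derivable_in A (fun u => pderivn A B i j f (u, y)) x
    & forall i j, (i + j <= r)%N ->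
        {within A `*` B, continuous (pderivn A B i j f)}].

(** * L^p and Hoelder norms *)

Definition normL (R : realType) (A : set R) (p : \bar R) (f : R -> \bar R) : \bar R :=
  'N[@lebesgue_measure R]_p[f \_ A].
Arguments normL {R} A%_classic p%_E f.

Definition modulus (R : realType) (A : set R) (g : R -> R) (t : R) : \bar R :=
  ereal_sup [set e : \bar R | exists x y,
    [/\ A x, A y, `|x - y| <= t & e = `|g x - g y|%:E]].

Definition holder_seminorm (R : realType) (A : set R) (beta : R) (f : R -> R) :
    \bar R :=
  let r := Num.truncn beta in
  ereal_sup [set e : \bar R | exists2 t : R, 0 < t &
    e = ((t `^ (r%:R - beta))%:E * modulus A (derivn_in A r f) t)%E].

(* H^beta(A), for beta >= 0 *)
Definition holder (R : realType) (A : set R) (beta : R) (f : R -> R) : Prop :=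
  Cr A (Num.truncn beta) f /\ (holder_seminorm A beta f < +oo)%E.

Definition holder_norm (R : realType) (A : set R) (beta : R) (f : R -> R) : \bar R :=
  (holder_seminorm A beta f + normL A +oo (EFin \o f))%E.

(* R^2 carries the maximum norm; another norm gives the same space. *)
Definition modulus2 (R : realType) (A : set (R * R)) (g : R * R -> R) (t : R) :
    \bar R :=
  ereal_sup [set e : \bar R | exists p q : R * R,
    [/\ A p, A q, Num.max `|p.1 - q.1| `|p.2 - q.2| <= t & e = `|g p - g q|%:E]].

Definition holder2_seminorm (R : realType) (A B : set R) (beta : R) (i j : nat)
    (f : R * R -> R) : \bar R :=
  ereal_sup [set e : \bar R | exists2 t : R, 0 < t &
    e = ((t `^ ((i + j)%:R - beta))%:E *
         modulus2 (A `*` B) (pderivn A B i j f) t)%E].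

(* H^beta(A x B), for beta >= 0: all derivatives of order floor(beta) count. *)
Definition holder2 (R : realType) (A B : set R) (beta : R) (f : R * R -> R) : Prop :=
  Cr2 A B (Num.truncn beta) f /\
  forall i j, (i + j)%N = Num.truncn beta ->
    (holder2_seminorm A B beta i j f < +oo)%E.

(** * The PDMP *)

(* [flow_inv phi x y] is [phi_x^-1 (y)]. For [y < x] it is the negative time
   which leads from [x] to [y], i.e. minus the time from [y] to [x]. *)
Definition flow_inv (R : realType) (phi : R -> R -> R) (x y : R) : R :=
  if x <= y then 'pinv_(fun=> 0) Rplus (phi x) y
  else - 'pinv_(fun=> 0) Rplus (phi y) x.

(* [(phi_x^-1)' (y)] *)
Definition dflow_inv (R : realType) (phi : R -> R -> R) (x y : R) : R :=
  deriv_in Rplus (flow_inv phi x) y.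

(* A homeomorphism [phi(., t)] is one onto its image: [phi(0, t) > 0] for
   [t > 0], so that image is never the whole half-line. *)
Definition is_flow (R : realType) (phi : R -> R -> R) : Prop :=
  [/\ Cr2 Rplus Rplus 1 (fun p => phi p.1 p.2),
      forall t, 0 <= t ->
        let D := (phi ^~ t) @` Rplus in
        [/\ D `<=` Rplus,
            set_inj Rplus (phi ^~ t),
            {within Rplus, continuous (phi ^~ t)}
          & {within D, continuous ('pinv_(fun=> 0) Rplus (phi ^~ t))}],
      forall x t s, 0 <= x -> 0 <= t -> 0 <= s ->
        phi x (t + s) = phi (phi x s) t
    & forall x, 0 <= x ->
        [/\ set_bij Rplus `[x, +oo[ (phi x),
            {in Rplus &, {homo phi x : s t / s < t}},
            Cr Rplus 1 (phi x)
          & Cr `[x, +oo[ 1 ('pinv_(fun=> 0) Rplus (phi x))]].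

Definition is_jump_rate (R : realType) (phi : R -> R -> R) (lam : R -> R) : Prop :=
  [/\ forall x, 0 <= x -> 0 <= lam x,
      measurable_fun Rplus lam
    & forall x, 0 <= x -> exists2 e : R, 0 < e &
        (\int[lebesgue_measure]_(s in `[0%R, e]) (lam (phi x s))%:E < +oo)%E].

Definition is_transition (R : realType)
    (Q : R.-pker (measurableTypeR R) ~> (measurableTypeR R)) : Prop :=
  forall x, 0 <= x -> Q x (Rplus `\ x) = 1%E.

(* [N z] is the law of the pre-jump location [Y_k] given [Z_(k-1) = z]. *)
Definition prejump_law (R : realType) (phi : R -> R -> R) (lam : R -> R)
    (N : R -> probability (measurableTypeR R) R) : Prop :=
  forall z y : R, 0 <= z -> z <= y ->
    N z `]y, +oo[%classic =
    expeR (- \int[lebesgue_measure]_(u in `[z, y]) (lam u * dflow_inv phi z u)%:E)%E.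

(* Expectation of [F ((Y_1, Z_1), ..., (Y_n, Z_n))] for the jump chain started
   at [Z_0 = z], as an iterated integral against its transition kernels. *)
Fixpoint chain_expectation (R : realType)
    (N : R -> probability (measurableTypeR R) R)
    (Q : R.-pker (measurableTypeR R) ~> (measurableTypeR R))
    (n : nat) (z : R) : (n.-tuple (R * R) -> \bar R) -> \bar R :=
  match n return (n.-tuple (R * R) -> \bar R) -> \bar R with
  | 0 => fun F => F [tuple]
  | n'.+1 => fun F =>
      (\int[N z]_y \int[Q y]_z'
         chain_expectation N Q z' (fun s : n'.-tuple (R * R) => F [tuple of (y, z') :: s]))%E
  end.

(** * Structural conditions *)

Definition condS1 (R : realType) (phi : R -> R -> R) (lam : R -> R)
    (Q : R.-pker (measurableTypeR R) ~> (measurableTypeR R)) (z0 kappa : R) : Prop :=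
  kappa < 1 /\
  exists2 N, prejump_law phi lam N &
    chain_expectation N Q z0 (fun s : 1.-tuple (R * R) =>
      (\1_[set p : R * R | p.2 <= kappa * p.1] (thead s))%:E) = 1%E.

Definition condS2 (R : realType) (phi : R -> R -> R) (m M : R -> R) : Prop :=
  forall x y, 0 <= x -> 0 <= y ->
    [/\ 0 < m y, m y <= dflow_inv phi x y & dflow_inv phi x y <= M y].

Definition rate_lower_bound (R : realType) (i1 a b : R) (m lam : R -> R) : Prop :=
  forall y, i1 <= y -> a * y `^ b / (b + 1) <= lam y * m y.

Definition condS3 (R : realType) (i1 a b : R) (m lam : R -> R) : Prop :=
  [/\ forall y, i1 <= y -> 0 < lam y, 0 < a, -1 < b
    & rate_lower_bound i1 a b m lam].

Definition early_hazard (R : realType) (i1 : R) (M lam : R -> R) : \bar R :=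
  (\int[lebesgue_measure]_(u in `[0%R, i1]) (lam u * M u)%:E)%E.

(* i_2' *)
Definition i2' (R : realType) (i1 i2 kappa a b : R) : R :=
  let k := kappa `^ (b + 1) in
  Num.max i2
    ((i2 - i1) +
     if 3^-1 <= k then ((a * (1 - k))^-1 * ln (2 * k / (1 - k))) `^ (b + 1)^-1
     else 0).

Definition condS4 (R : realType) (i1 i2 kappa a b l L : R) (M lam : R -> R) : Prop :=
  [/\ 0 < L, 0 < l,
      (normL `[i1, i2' i1 i2 kappa a b]%classic +oo (EFin \o lam) <= L%:E)%E
    & (early_hazard i1 M lam <= l%:E)%E].

(* Compact subsets of (0, oo) are taken to be intervals, and those of (0, oo)^2
   products of intervals. For [alpha < 1] the exponent [alpha - 1] is negative
   and no regularity is demanded of [Q1] and [p i]. *)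
Definition condS6 (R : realType) (phi : R -> R -> R) (lam : R -> R)
    (Q : R.-pker (measurableTypeR R) ~> (measurableTypeR R)) (alpha : R)
    (Q1 : R -> R -> R) (p : nat -> R -> R) (jQ : nat) (f : nat -> R -> R) : Prop :=
  0 < alpha /\
  [/\ forall c d z, 0 < c -> c < d -> 0 < z ->
        holder2 `[0, z] `[c, d] alpha (fun q => dflow_inv phi q.1 q.2),
      forall c d, 0 < c -> c < d -> holder `[c, d] alpha lam,
      forall x, 0 <= x -> forall B : set (measurableTypeR R), measurable B ->
        Q x B = (\int[lebesgue_measure]_(y in B `&` Rplus) (Q1 x y)%:E
                 + (p 0%N x)%:E * \d_(0%R : R) B
                 + \sum_(1 <= i < jQ.+1) (p i x)%:E * \d_(f i x) B)%E,
      1 <= alpha -> forall c d, 0 < c -> c < d ->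
        (forall c' d', 0 < c' -> c' < d' ->
           holder2 `[c, d] `[c', d'] (alpha - 1) (fun q => Q1 q.1 q.2)) /\
        (forall i, (i <= jQ)%N -> holder `[c, d] (alpha - 1) (p i))
    & forall i, (0 < i <= jQ)%N ->
        set_bij Rplus Rplus (f i) /\
        forall c d, 0 < c -> c < d ->
          holder `[c, d] alpha ('pinv_(fun=> 0) Rplus (f i))].

(** * The class of jump rates *)

(* J_k *)
Fixpoint Jset (R : realType) (i1 i2 : R) (jQ : nat) (f : nat -> R -> R) (k : nat) :
    set R :=
  match k with
  | 0 => `[i1, i2]%classic
  | k'.+1 =>
      smallest (@convex_set R R^o)
        (`[i1, i2] `|`
         \bigcup_(i in [set i | (0 < i <= jQ)%N])
           ('pinv_(fun=> 0) Rplus (f i) @` Jset i1 i2 jQ f k'))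
  end.

Definition Jfinal (R : realType) (i1 i2 kappa a b alpha : R) (jQ : nat)
    (f : nat -> R -> R) : set R :=
  Jset i1 i2 jQ f (Num.truncn alpha) `|` `[i1, i2' i1 i2 kappa a b].

(* E(s, b, alpha), with s = (a, l, L) and J the interval [Jfinal] *)
Definition rate_class (R : realType) (phi : R -> R -> R) (m M : R -> R)
    (i1 : R) (J : set R) (a l L b alpha : R) : set (R -> R) :=
  [set lam | is_jump_rate phi lam /\
    [/\ holder J alpha lam,
        rate_lower_bound i1 a b m lam,
        (early_hazard i1 M lam <= l%:E)%E
      & (holder_norm J alpha lam <= L%:E)%E]].

(* The class contains a rate whose norm is below the bound [L]. Without this
   no lower bound can hold: with [phi x t = x + t], [m = 1], [b = 0] and
   [a = L], the restriction to [i1, i2] of a rate of the class is the constant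
   [L]. Other constants give an empty class. *)
Definition slack_class (R : realType) (phi : R -> R -> R) (m M : R -> R)
    (i1 : R) (J : set R) (a l L b alpha : R) : Prop :=
  exists2 lam0, rate_class phi m M i1 J a l L b alpha lam0 &
    (holder_norm J alpha lam0 < L%:E)%E.

(** * Model conditions

    Elements of L^2([i1, i2]) are represented by functions on R, equality
    being equality almost everywhere on [i1, i2]. *)

Definition ae_eq_on (R : realType) (A : set R) (f g : R -> R) : Prop :=
  {ae @lebesgue_measure R, forall x, A x -> f x = g x}.

Definition inL2 (R : realType) (A : set R) (f : R -> R) : Prop :=
  measurable_fun A f /\ (normL A 2 (EFin \o f) < +oo)%E.

Definition inner (R : realType) (A : set R) (f g : R -> R) : R :=
  \int[lebesgue_measure]_(x in A) (f x * g x).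

Definition L2_subspace (R : realType) (A : set R) (V : set (R -> R)) : Prop :=
  [/\ V `<=` inL2 A,
      V (cst 0),
      forall c f g, V f -> V g -> V (fun x => c * f x + g x)
    & forall f g, V f -> inL2 A g -> ae_eq_on A f g -> V g].

Definition L2_basis (R : realType) (A : set R) (V : set (R -> R)) (d : nat)
    (e : 'I_d -> R -> R) : Prop :=
  (forall l, V (e l)) /\
  forall f, V f -> exists! c : 'rV[R]_d,
    ae_eq_on A f (fun x => \sum_(l < d) c ord0 l * e l x).

Definition orthonormal_basis (R : realType) (A : set R) (V : set (R -> R)) (d : nat)
    (e : 'I_d -> R -> R) : Prop :=
  L2_basis A V e /\ forall k l, inner A (e k) (e l) = (k == l)%:R.

(* omega_k(f, t)_2 on [i1, i2]: the k-th difference of step h is defined on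
   [i1, i2 - k h]. *)
Definition modulus_smoothness (R : realType) (i1 i2 : R) (k : nat) (f : R -> R)
    (t : R) : \bar R :=
  ereal_sup [set e : \bar R | exists2 h : R, 0 < h <= t &
    e = normL `[i1, i2 - k%:R * h] 2 (fun x =>
          (\sum_(j < k.+1) (-1) ^+ j * 'C(k, j)%:R * f (x + j%:R * h))%:E)].

Definition besov_seminorm (R : realType) (i1 i2 beta : R) (f : R -> R) : \bar R :=
  ereal_sup [set e : \bar R | exists2 t : R, 0 < t &
    e = ((t `^ (- beta))%:E *
         modulus_smoothness i1 i2 (Num.truncn beta).+1 f t)%E].

Definition besov_norm (R : realType) (i1 i2 beta : R) (f : R -> R) : \bar R :=
  (normL `[i1, i2] 2 (EFin \o f) + besov_seminorm i1 i2 beta f)%E.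

Definition model_conditions (R : realType) (i1 i2 : R) (S : nat -> set (R -> R))
    (D : nat -> nat) : Prop :=
  let I := `[i1, i2]%classic in
  [/\ (forall m, L2_subspace I (S m)) /\
      forall m, S m `<=` S m.+1 /\ exists e : 'I_(D m) -> R -> R, L2_basis I (S m) e,
      exists2 psi1 : R, 0 < psi1 & forall m s, S m s ->
        (normL I +oo (EFin \o s) ^+ 2 <=
         (psi1 * (D m)%:R)%:E * normL I 2 (EFin \o s) ^+ 2)%E,
      exists2 psi2 : R, 0 < psi2 & forall m, exists e : 'I_(D m) -> R -> R,
        orthonormal_basis I (S m) e /\
        (normL I +oo (fun x =>
           \sum_(l < D m) normL I +oo (EFin \o e l) * `|e l x|%:E)
         <= (psi2 * (D m)%:R)%:E)%E
    & exists rr : nat, exists2 C' : R, 0 < C' &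
        forall beta, 0 < beta <= rr%:R ->
        forall s, inL2 I s -> (besov_norm i1 i2 beta s < +oo)%E ->
        forall m sm, S m sm -> (forall v, S m v -> inner I (s \- sm) v = 0) ->
          (normL I 2 (EFin \o (s \- sm)%R) <=
           (C' * (D m)%:R `^ (- beta))%:E * besov_norm i1 i2 beta s)%E].

(** * Estimators and risk *)

(* An estimator maps [(Z_0, ((Y_1, Z_1), ..., (Y_n, Z_n)))] to a function. *)
Definition is_estimator (R : realType) (n : nat)
    (T : R * n.-tuple (R * R) -> R -> R) : Prop :=
  measurable_fun setT
    (fun q : measurableTypeR R * n.-tuple (measurableTypeR R * measurableTypeR R)
             * measurableTypeR R => T q.1 q.2 : measurableTypeR R).

Definition risk (R : realType) (i1 i2 z0 : R)
    (N : R -> probability (measurableTypeR R) R)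
    (Q : R.-pker (measurableTypeR R) ~> (measurableTypeR R))
    (n : nat) (T : R * n.-tuple (R * R) -> R -> R) (lam : R -> R) : \bar R :=
  chain_expectation N Q z0 (fun s : n.-tuple (R * R) =>
    normL `[i1, i2] 2 (EFin \o (T (z0, s) \- lam)%R) ^+ 2)%E.

(* The law [N] is determined on the half-line by [prejump_law], so the supremum
   is over the rates of the class [E]. *)
Definition max_risk (R : realType) (i1 i2 z0 : R) (phi : R -> R -> R)
    (Q : R.-pker (measurableTypeR R) ~> (measurableTypeR R))
    (E : set (R -> R)) (n : nat) (T : R * n.-tuple (R * R) -> R -> R) : \bar R :=
  ereal_sup [set v : \bar R | exists lam N,
    [/\ E lam, prejump_law phi lam N & v = risk i1 i2 z0 N Q T lam]].

Definition minimax_risk (R : realType) (i1 i2 z0 : R) (phi : R -> R -> R)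
    (Q : R.-pker (measurableTypeR R) ~> (measurableTypeR R))
    (E : set (R -> R)) (n : nat) : \bar R :=
  ereal_inf [set max_risk i1 i2 z0 phi Q E T |
             T in [set T : R * n.-tuple (R * R) -> R -> R | is_estimator T]].

(* Main.v *)
(* The infimum over estimators is bounded below by Assouad's lemma on a cube of
   rates. Cut [[i1, i2]] into [K] cells of length [h] and add to a rate with
   Hoelder norm below [L] a bump of height [A h ^ alpha] on each cell of a chosen
   set of cells; for small [A] these rates belong to the class. By the semigroup
   property every [(phi_x^-1)'] is the derivative [g] of the one function
   [phi_0^-1], so the pre-jump location is the first point after [z] of a point
   process whose intensity [rate * g] does not depend on [z].
   Let two intensities [h0 <= h1 = (1 + r) h0] differ on one cell. The density of
   the first point under [h1] is [w] times the one under [h0], and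
   [w ^ 2] times the latter is at most the density for the intensity
   [(1 + 2 r) h0] plus [r ^ 2 h0]. Hence one jump multiplies the second moment of
   the likelihood ratio by at most [1 + rho], where [rho] is the integral of
   [r ^ 2 h0], of order [h ^ (2 alpha + 1)], whatever [z] and [Q] are. With [K] of
   order [n ^ (1 / (2 alpha + 1))] the [n]-step second moment stays bounded, each
   cell costs a constant times [h ^ (2 alpha + 1)], and the [K] cells add up to
   the order [h ^ (2 alpha)]. *)

Require Import Defs.
From HB Require Import structures.
From mathcomp Require Import all_boot all_order all_algebra.
From mathcomp Require Import all_classical all_reals all_analysis.
From mathcomp Require Import measurable_realfun ess_sup_inf.
From mathcomp Require Import ring lra.

Set Implicit Arguments.
Unset Strict Implicit.
Unset Printing Implicit Defensive.

Import Order.TTheory GRing.Theory Num.Theory.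
Import numFieldNormedType.Exports.

Local Open Scope classical_set_scope.
Local Open Scope ring_scope.

(** Four points shape the argument. The risk is a supremum over pairs of a rate and a family of
    laws, so each rate of the cube needs an actual family satisfying [prejump_law]. It is built from
    the density [h y * expR (H z - H y)], with [H] the integral of the hazard [h]; its total mass is
    1 because [H] is finite and unbounded, and unboundedness comes from the lower bound on the rates
    with [b > -1]. The class says little about a rate above [i1] and outside [J], so finiteness of
    [H] is obtained by splicing a rate of the class with the given rate [lam]. The likelihood ratio
    of [n] jumps is never formed: since [chain_expectation] is an iterated integral, a weight [th]
    runs through an induction on [n], and the bound [c * th - c * th ^ 2 * (1 + rho) ^ n / 4] has a
    form that each jump reproduces. Finally the bound on [w ^ 2] uses a nonnegative increment, so a
    bump is always added to the lower of two neighbouring rates, and the opposite case follows by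
    exchanging the members of the pair. *)

(** * Densities and hazards *)

(* The integrals of [risk] are taken of functions that need not be measurable. *)
Lemma le_integral_ge0 d (T : measurableType d) (R : realType)
    (mu : {measure set T -> \bar R}) (D : set T) (f g : T -> \bar R) :
  (forall x, D x -> 0 <= f x)%E -> (forall x, D x -> f x <= g x)%E ->
  (\int[mu]_(x in D) f x <= \int[mu]_(x in D) g x)%E.
Proof.
move=> f0 fg.
have h0 x : (0 <= (f \_ D) x)%E by apply: erestrict_ge0.
have hg x : ((f \_ D) x <= (g \_ D) x)%E by apply: lee_restrict.
have h0' x : (0 <= (g \_ D) x)%E by exact: le_trans (h0 x) (hg x).
rewrite [leLHS]integral_mkcond [leRHS]integral_mkcond !ge0_integralTE//.
by apply: le_ereal_sup => _ [h hf <-]; exists h => // x; exact: le_trans (hg x).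
Qed.

(** * Probability measures given by a density *)

Section density.
Context {R : realType}.
Local Notation mu := (@lebesgue_measure R).
Local Open Scope ereal_scope.

Record pdf := Pdf {
  pdf_fun :> R -> R;
  pdf_ge0 : forall x, (0 <= pdf_fun x)%R;
  measurable_pdf : measurable_fun setT pdf_fun;
  integral_pdf : \int[mu]_x (pdf_fun x)%:E = 1 }.

Definition pdf_prob (q : pdf) : set (measurableTypeR R) -> \bar R :=
  fun U => \int[mu]_(x in U) (q x)%:E.

Section pdf_prob.
Variable q : pdf.

Let pdf_prob0 : pdf_prob q set0 = 0.
Proof. by rewrite /pdf_prob integral_set0. Qed.

Let pdf_prob_ge0 U : 0 <= pdf_prob q U.
Proof. by apply: integral_ge0 => x _; rewrite lee_fin pdf_ge0. Qed.

Let pdf_prob_sigma_additive : semi_sigma_additive (pdf_prob q).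
Proof.
move=> /= F mF tF mUF; rewrite /pdf_prob; apply: cvg_toP.
  apply: ereal_nondecreasing_is_cvgn => m n mn.
  apply: lee_sum_nneg_natr => // k _ _.
  by apply: integral_ge0 => /= x Fkx; rewrite lee_fin pdf_ge0.
rewrite ge0_integral_bigcup//=.
- apply/measurable_EFinP; apply: measurable_funTS; exact: measurable_pdf.
- by move=> x _; rewrite lee_fin pdf_ge0.
Qed.

HB.instance Definition _ := isMeasure.Build _ _ _ (pdf_prob q)
  pdf_prob0 pdf_prob_ge0 pdf_prob_sigma_additive.

Let pdf_prob_setT : pdf_prob q [set: _] = 1%:E.
Proof. exact: integral_pdf. Qed.

HB.instance Definition _ := @Measure_isProbability.Build _ _ R
  (pdf_prob q) pdf_prob_setT.

Let measurable_EFin_pdf : measurable_fun setT (EFin \o q).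
Proof. by apply: measurableT_comp => //; exact: measurable_pdf. Qed.

Import HBNNSimple.

Let integral_pdf_prob_nnsfun (f : {nnsfun (measurableTypeR R) >-> R}) :
  \int[pdf_prob q]_x (f x)%:E = \int[mu]_x ((f x)%:E * (q x)%:E).
Proof.
under [LHS]eq_integral do rewrite fimfunE -fsumEFin//.
rewrite [LHS]ge0_integral_fsum//; last 2 first.
  - by move=> r; exact/measurable_EFinP/measurableT_comp.
  - by move=> n x _; rewrite EFinM nnfun_muleindic_ge0.
under [RHS]eq_integral.
  move=> x xD; rewrite fimfunE -fsumEFin// ge0_mule_fsuml; last first.
    by move=> r; rewrite EFinM nnfun_muleindic_ge0.
  over.
rewrite [RHS]ge0_integral_fsum//; last 2 first.
  - move=> r; apply: emeasurable_funM => //.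
    by apply/measurable_EFinP; do 2 apply/measurableT_comp => //.
  - move=> n x _; rewrite mule_ge0 ?lee_fin ?pdf_ge0//.
    by rewrite -lee_fin EFinM nnfun_muleindic_ge0.
apply: eq_fsbigr => r _; rewrite integralZl_indic_nnsfun//= integral_indic//=.
rewrite setIT /pdf_prob [in LHS]integral_mkcond.
have [r0|r0] := leP 0%R r; last first.
  rewrite preimage_nnfun0// [in LHS]integral0_eq ?mule0; last first.
    by move=> x _; rewrite patchE in_set0.
  by rewrite integral0_eq// => x _; rewrite indicE in_set0 mulr0 mul0e.
rewrite -ge0_integralZl//=.
- apply: eq_integral => x _; rewrite patchE indicE; case: ifPn => xr.
    by rewrite mulr1.
  by rewrite mule0 mulr0 mul0e.
- by apply/(measurable_restrictT _ _).1 => //; exact: measurable_funTS.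
- by move=> x _; apply: erestrict_ge0 => y _; rewrite lee_fin pdf_ge0.
Qed.

Lemma integral_pdf_prob (f : measurableTypeR R -> \bar R) :
  measurable_fun setT f -> (forall x, 0 <= f x) ->
  \int[pdf_prob q]_x f x = \int[mu]_x (f x * (q x)%:E).
Proof.
move=> mf f0.
pose f_ := nnsfun_approx measurableT mf.
transitivity (lim (\int[pdf_prob q]_x (f_ n x)%:E @[n --> \oo])).
  rewrite -monotone_convergence//=.
  - apply: eq_integral => ? /[!inE] xD; apply/esym/cvg_lim => //=.
    exact: cvg_nnsfun_approx.
  - by move=> n; apply/measurable_EFinP; exact: measurable_funPT.
  - by move=> n ? _; rewrite lee_fin; exact: fun_ge0.
  - by move=> ? _ ? ? mn; rewrite lee_fin; exact/lefP/nd_nnsfun_approx.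
transitivity (lim (\int[mu]_x ((f_ n x)%:E * (q x)%:E) @[n --> \oo])).
  by apply: congr_lim; apply/funext => n /=; exact: integral_pdf_prob_nnsfun.
rewrite -monotone_convergence//=.
- apply: eq_integral => x /[!inE] xD; apply/cvg_lim => //=.
  apply: cvgeZr => //.
  exact: cvg_nnsfun_approx.
- move=> n; apply: emeasurable_funM => //.
  apply/measurable_EFinP; exact: measurable_funPT.
- by move=> n x _; rewrite mule_ge0 ?lee_fin ?pdf_ge0 ?fun_ge0.
- move=> x _ m n mn; rewrite lee_wpmul2r ?lee_fin ?pdf_ge0//.
  exact/lefP/nd_nnsfun_approx.
Qed.

End pdf_prob.
End density.

Lemma ler_dist_itv (R : realFieldType) (lo up x y : R) :
  lo <= x <= up -> lo <= y <= up -> `|x - y| <= up - lo.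
Proof.
by move=> /andP[? ?] /andP[? ?]; rewrite ler_norml; apply/andP; split; lra.
Qed.

(** Both sides are [1 + x <= expR x], at [x = b - a] and at [x = - (b - a)], after factoring out one
    exponential. *)
Lemma expR_increment_bounds (R : realType) (a b : R) : a <= b ->
  expR (- b) * (b - a) <= expR (- a) - expR (- b) <= expR (- a) * (b - a).
Proof.
move=> ab; apply/andP; split.
  have -> : expR (- a) = expR (- b) * expR (b - a).
    by rewrite -expRD; congr expR; ring.
  rewrite -{3}[expR (- b)]mulr1 -mulrBr ler_wpM2l ?expR_ge0//.
  by rewrite lerBrDl expR_ge1Dx.
have -> : expR (- b) = expR (- a) * expR (- (b - a)).
  by rewrite -expRD; congr expR; ring.
rewrite -[X in X - _]mulr1 -mulrBr ler_wpM2l ?expR_ge0//.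
by rewrite lerBlDr -lerBlDl expR_ge1Dx.
Qed.

(** * Hazards and their survival functions *)

HB.lock Definition cumhaz (R : realType) (h : R -> R) (y : R) : R :=
  \int[@lebesgue_measure R]_(u in `[0, y]) h u.
Canonical cumhaz_unlockable := Unlockable cumhaz.unlock.

Section hazard.
Context {R : realType}.
Local Notation mu := (@lebesgue_measure R).

(** [hazard_fin] makes the cumulative hazard a real number; [hazard_div] makes the survival
    probability tend to 0, so that the first jump happens almost surely. *)
Record hazard := Hazard {
  hazard_fun :> R -> R;
  hazard_ge0 : forall x, 0 <= hazard_fun x;
  measurable_hazard : measurable_fun setT hazard_fun;
  hazard_fin : forall y, (\int[mu]_(u in `[0%R, y]) (hazard_fun u)%:E < +oo)%E;
  hazard_div : forall A : R, exists2 y, 0 <= y &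
    (A%:E <= \int[mu]_(u in `[0%R, y]) (hazard_fun u)%:E)%E }.

Section cumhaz.
Variable h : hazard.

Let measurable_EFin_hazard D : measurable_fun D (fun x : measurableTypeR R => (h x)%:E).
Proof.
apply/measurable_EFinP; apply: measurable_funTS; exact: measurable_hazard.
Qed.

Lemma cumhazE y : (cumhaz h y)%:E = (\int[mu]_(u in `[0%R, y]) (h u)%:E)%E.
Proof.
rewrite unlock /Rintegral fineK// ge0_fin_numE ?hazard_fin//.
by apply: integral_ge0 => u _; rewrite lee_fin hazard_ge0.
Qed.

Lemma cumhaz_ge0 y : 0 <= cumhaz h y.
Proof. by rewrite unlock; apply: Rintegral_ge0 => u _; exact: hazard_ge0. Qed.

Lemma cumhaz_le0 y : y <= 0 -> cumhaz h y = 0.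
Proof.
rewrite le_eqVlt => /predU1P[->|y0]; rewrite unlock.
  by rewrite set_itv1 Rintegral_set1.
by rewrite set_itv_ge ?Rintegral_set0// -leNgt bnd_simp.
Qed.

Lemma integral_hazard s t : 0 <= s -> s <= t ->
  (\int[mu]_(u in `]s, t]) (h u)%:E = (cumhaz h t - cumhaz h s)%:E)%E.
Proof.
move=> s0 st; rewrite EFinB !cumhazE.
rewrite (@itv_bndbnd_setU _ _ (BLeft 0) (BRight s) (BRight t)) ?bnd_simp//.
rewrite ge0_integral_setU//=.
- rewrite addeAC subee ?add0e// -cumhazE//.
- by move=> u _; rewrite lee_fin hazard_ge0.
- apply/disj_set2P; rewrite -subset0 => z/=; rewrite !in_itv/= => -[/andP[_]].
  by rewrite leNgt => /negbTE ->.
Qed.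

Lemma integral_hazard_cc s t : 0 <= s -> s <= t ->
  (\int[mu]_(u in `[s, t]) (h u)%:E = (cumhaz h t - cumhaz h s)%:E)%E.
Proof.
move=> s0 st; rewrite -integral_hazard// integral_itv_obnd_cbnd//.
exact: measurable_EFin_hazard.
Qed.

Lemma cumhaz_nd : {homo cumhaz h : s t / s <= t}.
Proof.
move=> s t st; have [s0|s0] := leP 0 s; last first.
  by rewrite (cumhaz_le0 (ltW s0)) cumhaz_ge0.
rewrite -subr_ge0 -lee_fin -integral_hazard//.
by apply: integral_ge0 => u _; rewrite lee_fin hazard_ge0.
Qed.

Lemma measurable_cumhaz : measurable_fun setT (cumhaz h).
Proof. by apply: nondecreasing_measurable => // s t; exact: cumhaz_nd. Qed.

(** A hazard is only measurable, so [cumhaz] cannot be differentiated pointwise; its continuity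
    suffices to find a point that halves an increment. *)
Lemma cumhaz_IVT s t v : 0 <= s -> s <= t ->
  cumhaz h s <= v <= cumhaz h t -> exists2 c, s <= c <= t & cumhaz h c = v.
Proof.
move=> s0 st vst; have t0 := le_trans s0 st.
have int0t : mu.-integrable `[0, t] (EFin \o h).
  apply/integrableP; split => //.
  under eq_integral do rewrite gee0_abs ?lee_fin ?hazard_ge0//.
  exact: hazard_fin.
have := parameterized_integral_continuous t0 int0t.
rewrite (_ : (fun x => _) = cumhaz h) => [cH|]; last by rewrite unlock.
have cH' : {within `[s, t], continuous (cumhaz h)}.
  apply: continuous_subspaceW cH => x /=; rewrite !in_itv/= => /andP[sx ->].
  by rewrite (le_trans s0 sx).
have [|c] := @IVT R (cumhaz h) s t v st cH'.
  rewrite min_l ?max_r//; exact: cumhaz_nd.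
by rewrite in_itv/=; exists c.
Qed.

Let surv (u : R) : R := h u * expR (- cumhaz h u).

Let surv_ge0 u : 0 <= surv u.
Proof. by rewrite mulr_ge0 ?hazard_ge0 ?expR_ge0. Qed.

Let measurable_surv : measurable_fun setT surv.
Proof.
apply: measurable_funM; first exact: measurable_hazard.
apply: measurableT_comp => //; apply: measurableT_comp => //.
exact: measurable_cumhaz.
Qed.

Let measurable_EFin_surv D : measurable_fun D (fun x : measurableTypeR R => (surv x)%:E).
Proof. by apply/measurable_EFinP; apply: measurable_funTS. Qed.

Let Isurv s t := fine (\int[mu]_(u in `]s, t]) (surv u)%:E).

Let IsurvE_bounds s t : 0 <= s -> s <= t ->
  [/\ (Isurv s t)%:E = (\int[mu]_(u in `]s, t]) (surv u)%:E)%E,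
      expR (- cumhaz h t) * (cumhaz h t - cumhaz h s) <= Isurv s t &
      Isurv s t <= expR (- cumhaz h s) * (cumhaz h t - cumhaz h s)].
Proof.
move=> s0 st.
have up : (\int[mu]_(u in `]s, t]) (surv u)%:E <=
    (expR (- cumhaz h s) * (cumhaz h t - cumhaz h s))%:E)%E.
  rewrite EFinM -integral_hazard// -ge0_integralZl//=; last first.
    by move=> u _; rewrite lee_fin hazard_ge0.
  apply: le_integral_ge0 => u; first by move=> _; rewrite lee_fin.
  move=> ust; have /andP[su ut] : s < u <= t by move: ust; rewrite /= in_itv.
  rewrite -EFinM lee_fin [leLHS]mulrC; apply: ler_wpM2r; first exact: hazard_ge0.
  by rewrite ler_expR lerN2 cumhaz_nd// ltW.
have lo : ((expR (- cumhaz h t) * (cumhaz h t - cumhaz h s))%:E <=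
    \int[mu]_(u in `]s, t]) (surv u)%:E)%E.
  rewrite EFinM -integral_hazard// -ge0_integralZl//=; last first.
    by move=> u _; rewrite lee_fin hazard_ge0.
  apply: le_integral_ge0 => u.
    by move=> _; rewrite -EFinM lee_fin mulr_ge0 ?expR_ge0 ?hazard_ge0.
  move=> ust; have /andP[su ut] : s < u <= t by move: ust; rewrite /= in_itv.
  rewrite -EFinM lee_fin [leRHS]mulrC; apply: ler_wpM2r; first exact: hazard_ge0.
  by rewrite ler_expR lerN2 cumhaz_nd.
have E : (Isurv s t)%:E = (\int[mu]_(u in `]s, t]) (surv u)%:E)%E.
  rewrite /Isurv fineK// ge0_fin_numE ?(le_lt_trans up) ?ltry//.
  by apply: integral_ge0 => u _; rewrite lee_fin.
by split => //; rewrite -lee_fin E.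
Qed.

Let Isurv_add s c t : 0 <= s -> s <= c -> c <= t ->
  Isurv s t = Isurv s c + Isurv c t.
Proof.
move=> s0 sc ct; apply: EFin_inj; rewrite EFinD.
have [-> _ _] := IsurvE_bounds s0 (le_trans sc ct).
have [-> _ _] := IsurvE_bounds s0 sc.
have [-> _ _] := IsurvE_bounds (le_trans s0 sc) ct.
rewrite (@itv_bndbnd_setU _ _ (BRight s) (BRight c) (BRight t)) ?bnd_simp//.
rewrite ge0_integral_setU//=.
- by move=> u _; rewrite lee_fin.
- apply/disj_set2P; rewrite -subset0 => z/=; rewrite !in_itv/= => -[/andP[_]].
  by rewrite leNgt => /negbTE ->.
Qed.

(* The defect below is additive in the interval and quadratic in the increment
   of [cumhaz h], so halving the increment repeatedly shows that it vanishes. *)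
Let defect s t := Isurv s t - (expR (- cumhaz h s) - expR (- cumhaz h t)).

Let defect_le k s t : 0 <= s -> s <= t ->
  `|defect s t| <= (cumhaz h t - cumhaz h s) ^+ 2 / 2 ^+ k.
Proof.
elim: k s t => [|k IH] s t s0 st.
  rewrite expr0 divr1; have [_ lo up] := IsurvE_bounds s0 st.
  have d0 : 0 <= cumhaz h t - cumhaz h s by rewrite subr_ge0 cumhaz_nd.
  have /andP[lo' up'] := expR_increment_bounds (cumhaz_nd st).
  (* The integral and the increment of the exponential lie in the same interval, whose length is
     estimated by [expR_increment_bounds] once more; this gives the square. *)
  apply: (@le_trans _ _ ((expR (- cumhaz h s) - expR (- cumhaz h t)) *
                         (cumhaz h t - cumhaz h s))).
    by rewrite mulrBl; apply: ler_dist_itv; apply/andP.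
  rewrite expr2 ler_wpM2r// (le_trans up')// ler_piMl//.
  by rewrite -expR0 ler_expR oppr_le0 cumhaz_ge0.
(* The midpoint is taken on the scale of [cumhaz], not of time: each half then has a quarter of the
   square, and the two together half of it. *)
pose v := (cumhaz h s + cumhaz h t) / 2.
have Hst := cumhaz_nd st.
have [|c /andP[sc ct] cv] := @cumhaz_IVT s t v s0 st.
  by rewrite !midf_le.
have -> : defect s t = defect s c + defect c t.
  rewrite /defect (Isurv_add s0 sc ct).
  move: (Isurv s c) (Isurv c t) (expR (- cumhaz h s)) (expR (- cumhaz h c)).
  by move: (expR (- cumhaz h t)) => *; ring.
apply: (le_trans (ler_normD _ _)).
apply: (le_trans (lerD (IH _ _ s0 sc) (IH _ _ (le_trans s0 sc) ct))).
rewrite -mulrDl [2 ^+ k.+1]exprS invfM mulrA ler_wpM2r ?invr_ge0 ?exprn_ge0//.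
rewrite cv /v le_eqVlt; apply/orP; left; apply/eqP.
by move: (cumhaz h s) (cumhaz h t) => x y; field.
Qed.

Let defect0 s t : 0 <= s -> s <= t -> defect s t = 0.
Proof.
move=> s0 st; apply/eqP; rewrite -normr_le0; apply/ler_addgt0Pr => e e0.
rewrite add0r; set d := (cumhaz h t - cumhaz h s) ^+ 2.
have d0 : 0 <= d by exact: sqr_ge0.
have [k dk] : exists k, d / e <= 2 ^+ k.
  exists (Num.truncn (d / e)).+1.
  have : d / e < (Num.truncn (d / e)).+1%:R by apply: truncnS_gt.
  move/ltW/le_trans; apply.
  rewrite -natrX ler_nat; exact/ltnW/ltn_expl.
apply: (le_trans (defect_le k s0 st)).
by rewrite ler_pdivrMr ?exprn_gt0// mulrC -ler_pdivrMr.
Qed.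

(** On bounded intervals [defect0] plays the role of the fundamental theorem of calculus for
    [- expR (- cumhaz h)]; the half-line follows by monotone exhaustion, the term at infinity
    vanishing by [hazard_div]. *)
Lemma integral_survival y : 0 <= y ->
  (\int[mu]_(u in `]y, +oo[) (h u * expR (- cumhaz h u))%:E
   = (expR (- cumhaz h y))%:E)%E.
Proof.
move=> y0.
have yF : `]y, +oo[%classic = \bigcup_n `]y, y + n%:R]%classic.
  apply/seteqP; split => [x /=|x [n _ /=]]; rewrite !in_itv/= andbT.
    move=> yx; exists (Num.truncn (x - y)).+1 => //=.
    rewrite in_itv/= yx/= -lerBlDl ltW//; exact: truncnS_gt.
  by move=> /andP[].
have ndF : nondecreasing_seq (fun n => `]y, y + n%:R]%classic).
  move=> m n mn; apply/subsetPset => x /=; rewrite !in_itv/= => /andP[-> xm] /=.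
  by rewrite (le_trans xm)// lerD2l ler_nat.
have E n : (\int[mu]_(u in `]y, (y + n%:R)%R]) (surv u)%:E =
    (expR (- cumhaz h y) - expR (- cumhaz h (y + n%:R)))%:E)%E.
  have yn : y <= y + n%:R by rewrite lerDl.
  have [<- _ _] := IsurvE_bounds y0 yn.
  by congr EFin; apply/eqP; rewrite -subr_eq0; apply/eqP; exact: defect0.
have := @ge0_nondecreasing_set_cvg_integral _ (measurableTypeR R) R
   (fun n => `]y, y + n%:R]%classic) (EFin \o surv) mu ndF (fun=> measurable_itv _).
rewrite -yF => /(_ _ _)/cvg_lim <-//; last by move=> i u _; rewrite lee_fin.
apply/cvg_lim => //.
rewrite (funext E).
apply: cvg_EFin; first exact: nearW.
rewrite -[X in _ --> X]subr0.
apply: cvgB; first exact: cvg_cst.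
apply/cvgrPdist_le => /= e e0.
have [y1 y10 Hy1] := hazard_div h (- ln e).
exists (Num.truncn y1).+1 => // n /= ny1.
rewrite sub0r normrN ger0_norm ?expR_ge0//.
rewrite -(lnK e0) ler_expR lerNl.
move: Hy1; rewrite -cumhazE lee_fin => /le_trans; apply.
apply: cumhaz_nd; apply: (@le_trans _ _ n%:R); last by rewrite lerDr.
rewrite (le_trans (ltW (truncnS_gt y1)))// ler_nat//.
Qed.

End cumhaz.
End hazard.

(** * Law of the first jump under a hazard, and likelihood ratios *)

Section first_jump.
Context {R : realType}.
Local Notation mu := (@lebesgue_measure R).
Implicit Types (z y : R).

(** The cut at [Num.max z 0] keeps this a probability density for negative [z] too, where [cumhaz]
    is 0: a family of laws is indexed by all reals. *)
Definition first_jump (h : R -> R) (z y : R) : R :=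
  if Num.max z 0 < y then h y * expR (cumhaz h z - cumhaz h y) else 0.

Lemma first_jump_ge0 (h : hazard) z y : 0 <= first_jump h z y.
Proof.
by rewrite /first_jump; case: ifP => // _; rewrite mulr_ge0 ?hazard_ge0 ?expR_ge0.
Qed.

Lemma measurable_first_jump (h : hazard) :
  measurable_fun setT (fun p : measurableTypeR R * measurableTypeR R =>
    first_jump h p.1 p.2 : measurableTypeR R).
Proof.
have mH : measurable_fun setT (cumhaz h : measurableTypeR R -> measurableTypeR R).
  exact: measurable_cumhaz.
have mh : measurable_fun setT (h : measurableTypeR R -> measurableTypeR R).
  exact: measurable_hazard.
apply: measurable_fun_ifT => //=.
  apply: (@measurable_fun_ltr _ _ _ _
     (fun p : measurableTypeR R * measurableTypeR R => Num.max p.1 0) snd) => //.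
  exact: measurable_maxr.
apply: measurable_funM; first exact: measurableT_comp.
apply: measurableT_comp => //.
by apply: measurable_funB; exact: measurableT_comp.
Qed.

Lemma cumhaz_max0 (h : hazard) z : cumhaz h (Num.max z 0) = cumhaz h z.
Proof.
by have [z0|//] := leP z 0; rewrite !(cumhaz_le0 h).
Qed.

Lemma integral_first_jump (h : hazard) z y : 0 <= y -> z <= y ->
  (\int[mu]_(u in `]y, +oo[) (first_jump h z u)%:E
   = (expR (cumhaz h z - cumhaz h y))%:E)%E.
Proof.
move=> y0 zy.
have yz : Num.max z 0 <= y by rewrite ge_max zy.
rewrite expRD EFinM -integral_survival// -ge0_integralZl//; last 2 first.
- apply/measurable_EFinP; apply: measurable_funTS.
  apply: measurable_funM; first exact: measurable_hazard.
  apply: measurableT_comp => //; apply: measurableT_comp => //.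
  exact: measurable_cumhaz.
- by move=> u _; rewrite lee_fin mulr_ge0 ?hazard_ge0 ?expR_ge0.
apply: eq_integral => u; rewrite inE/= in_itv/= andbT => yu.
rewrite /first_jump (le_lt_trans yz yu) -EFinM; congr EFin.
by rewrite expRD mulrCA.
Qed.

Let integral_first_jumpT (h : hazard) z :
  (\int[mu]_u (first_jump h z u)%:E = 1)%E.
Proof.
transitivity (\int[mu]_(u in `]Num.max z 0%R, +oo[) (first_jump h z u)%:E)%E.
  rewrite [RHS]integral_mkcond; apply: eq_integral => u _.
  rewrite patchE mem_setE in_itv/= andbT; case: ifPn => // zu.
  by rewrite /first_jump ifN.
rewrite integral_first_jump ?le_max ?lexx ?orbT//.
by rewrite cumhaz_max0 subrr expR0.
Qed.

Let measurable_first_jump2 (h : hazard) z : measurable_fun setT (first_jump h z).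
Proof.
exact: (measurableT_comp (measurable_first_jump h) (@measurable_pair1 _ _
  (measurableTypeR R) (measurableTypeR R) z)).
Qed.

Definition first_jump_pdf (h : hazard) (z : R) : pdf := Pdf
  (first_jump_ge0 h z) (@measurable_first_jump2 h z) (integral_first_jumpT h z).

Lemma first_jump_tail (h : hazard) z y : 0 <= z -> z <= y ->
  pdf_prob (first_jump_pdf h z) `]y, +oo[%classic =
  expeR (- \int[mu]_(u in `[z, y]) (h u)%:E).
Proof.
move=> z0 zy; rewrite /pdf_prob/= integral_first_jump ?(le_trans z0 zy)//.
by rewrite integral_hazard_cc// -EFinN/= opprB.
Qed.

(** The three hazards are in arithmetic progression, with factors [1], [1 + r], [1 + 2 r]. The
    relation is written with sums so that additivity of nonnegative integrals applies. *)
Lemma cumhaz_add (h0 h1 h2 : hazard) y :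
  (forall u, h0 u + h2 u = h1 u + h1 u) ->
  cumhaz h0 y + cumhaz h2 y = cumhaz h1 y + cumhaz h1 y.
Proof.
move=> E; apply: EFin_inj; rewrite !EFinD !cumhazE.
have m (h : hazard) : measurable_fun `[0, y] (fun u : measurableTypeR R => (h u)%:E).
  apply/measurable_EFinP; apply: measurable_funTS; exact: measurable_hazard.
have p (h : hazard) (u : R) : `[0, y]%classic u -> (0 <= (h u)%:E)%E.
  by move=> _; rewrite lee_fin hazard_ge0.
rewrite -!ge0_integralD//; [|exact: p|exact: m|exact: p|exact: m
                            |exact: p|exact: m|exact: p|exact: m].
by apply: eq_integral => u _; rewrite -!EFinD E.
Qed.

(* [h2] is the hazard for which the second moment of the likelihood ratio [w]
   of the first jump under [h1] and [h0] becomes the total mass of a density. *)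
Lemma first_jump_ratio (h0 h1 h2 : hazard) (r : R -> R) z y :
  (forall u, 0 <= r u) ->
  (forall u, h1 u = (1 + r u) * h0 u) ->
  (forall u, h2 u = (1 + 2 * r u) * h0 u) ->
  let w := (1 + r y) * expR ((cumhaz h1 z - cumhaz h0 z) -
                             (cumhaz h1 y - cumhaz h0 y)) in
  first_jump h1 z y = w * first_jump h0 z y /\
  w ^+ 2 * first_jump h0 z y <= first_jump h2 z y + r y ^+ 2 * h0 y.
Proof.
move=> r0 E1 E2 w.
have E02 u : cumhaz h2 u = cumhaz h1 u + cumhaz h1 u - cumhaz h0 u.
  rewrite -(@cumhaz_add h0 h1 h2); first by rewrite [_ + _ - _]addrAC subrr add0r.
  move=> v; rewrite E1 E2; move: (h0 v) (r v) => *; ring.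
rewrite /first_jump; case: ifPn => [zy|_]; last first.
  rewrite !mulr0 add0r; split => //.
  by rewrite mulr_ge0 ?sqr_ge0 ?hazard_ge0.
have zy' : z <= y by rewrite (le_trans _ (ltW zy))// le_max lexx.
have H2 : expR (cumhaz h2 z - cumhaz h2 y) <= 1.
  by rewrite -expR0 ler_expR subr_le0 cumhaz_nd.
(* Because [cumhaz h2 - cumhaz h1 = cumhaz h1 - cumhaz h0], the squared ratio of survival factors
   turns the survival factor of [h0] into that of [h2]. *)
have e2 : expR (cumhaz h2 z - cumhaz h2 y) =
    expR ((cumhaz h1 z - cumhaz h0 z) - (cumhaz h1 y - cumhaz h0 y)) ^+ 2 *
    expR (cumhaz h0 z - cumhaz h0 y).
  rewrite expr2 -!expRD !E02; congr expR.
  by move: (cumhaz h0 z) (cumhaz h0 y) (cumhaz h1 z) (cumhaz h1 y) => *; ring.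
have e1 : expR (cumhaz h1 z - cumhaz h1 y) =
    expR ((cumhaz h1 z - cumhaz h0 z) - (cumhaz h1 y - cumhaz h0 y)) *
    expR (cumhaz h0 z - cumhaz h0 y).
  rewrite -!expRD; congr expR.
  by move: (cumhaz h0 z) (cumhaz h0 y) (cumhaz h1 z) (cumhaz h1 y) => *; ring.
rewrite e1 {}/w; move: H2; rewrite e2 E1 E2.
move: (hazard_ge0 h0 y).
move: (expR _) (expR _) (h0 y) (r y) => f e a c a0 ef1; split; first by ring.
(* In [(1 + c) ^ 2 = (1 + 2 c) + c ^ 2] the first part yields exactly the density under [h2]; in the
   second the survival factor of [h2] is bounded by 1. *)
have -> : ((1 + c) * e) ^+ 2 * (a * f) =
  (1 + 2 * c) * a * (e ^+ 2 * f) + c ^+ 2 * a * (e ^+ 2 * f) by ring.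
by rewrite lerD2l ler_piMr// mulr_ge0// sqr_ge0.
Qed.

End first_jump.

Section hazard_construction.
Context {R : realType}.
Local Notation mu := (@lebesgue_measure R).
Local Notation T := (measurableTypeR R).

(* On each dyadic interval [[y0 2^n, y0 2^(n+1)]] the function [c / u] has
   integral at least [c / 2]. *)
Lemma integral_inv_diverges (k : R -> R) (c y0 : R) :
  (forall u, 0 <= k u) -> measurable_fun setT (k : T -> T) ->
  0 < c -> 0 < y0 -> (forall u, y0 <= u -> c / u <= k u) ->
  forall A : R, exists2 y, 0 <= y &
    (A%:E <= \int[mu]_(u in `[0%R, y]) (k u)%:E)%E.
Proof.
move=> k0 mk c0 y00 kc A.
have mk' (D : set R) : measurable_fun D (fun u : T => (k u)%:E).
  by apply/measurable_EFinP; exact: measurable_funTS.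
have step n : ((n%:R * (c / 2))%:E <=
    \int[mu]_(u in `[0%R, (y0 * 2 ^+ n)%R]) (k u)%:E)%E.
  elim: n => [|n IH].
    by rewrite mul0r; apply: integral_ge0 => u _; rewrite lee_fin.
  have yn0 : 0 < y0 * 2 ^+ n by rewrite mulr_gt0// exprn_gt0.
  have ynS : y0 * 2 ^+ n.+1 = 2 * (y0 * 2 ^+ n) by rewrite exprS; ring.
  have y0yn : y0 <= y0 * 2 ^+ n by rewrite ler_peMr ?(ltW y00)// exprn_ege1// ler1n.
  rewrite ynS; move: (y0 * 2 ^+ n) yn0 y0yn IH => {ynS} y yp0 y0y IH.
  have yy : y <= 2 * y by lra.
  rewrite (@itv_bndbnd_setU _ _ (BLeft 0) (BRight y) (BRight (2 * y)))
    ?bnd_simp ?(ltW yp0)//.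
  rewrite ge0_integral_setU//=.
  - rewrite -natr1 mulrDl mul1r EFinD leeD//.
    have -> : (c / 2)%:E = (\int[mu]_(u in `]y, (2 * y)%R]) (c / (2 * y))%:E)%E.
      rewrite integral_cst//= lebesgue_measure_itv/= lte_fin.
      rewrite ifT; last lra.
      by rewrite -EFinD -EFinM; congr EFin; field; rewrite gt_eqF.
    apply: le_integral_ge0 => u; first by rewrite lee_fin divr_ge0// ltW// mulr_gt0.
    move=> uy; have /andP[yu u2y] : y < u <= 2 * y by move: uy; rewrite /= in_itv.
    have u0 : 0 < u by exact: lt_trans yu.
    rewrite lee_fin (le_trans _ (kc u _))//; last by rewrite (le_trans y0y)// ltW.
    by rewrite ler_wpM2l ?(ltW c0)// lef_pV2// posrE mulr_gt0.
  - exact: mk'.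
  - by move=> u _; rewrite lee_fin.
  - apply/disj_set2P; rewrite -subset0 => z/=; rewrite !in_itv/= => -[/andP[_]].
    by rewrite leNgt => /negbTE ->.
have c20 : 0 < c / 2 by rewrite divr_gt0.
exists (y0 * 2 ^+ (Num.truncn (A / (c / 2))).+1).
  by rewrite mulr_ge0 ?exprn_ge0// ltW.
apply: le_trans (step _); rewrite lee_fin -ler_pdivrMr//.
exact/ltW/truncnS_gt.
Qed.

Section hazard_add.
Variables (h : @hazard R) (d : R -> R).
Hypothesis d_ge0 : forall u, 0 <= d u.
Hypothesis measurable_d : measurable_fun setT (d : T -> T).
Hypothesis d_bounded : forall y, exists C, forall u, 0 <= u <= y -> d u <= C.

Let hd_ge0 u : 0 <= h u + d u.
Proof. by rewrite addr_ge0 ?hazard_ge0. Qed.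

Let measurable_hd : measurable_fun setT (fun u : T => h u + d u : T).
Proof. by apply: measurable_funD => //; exact: measurable_hazard. Qed.

Let hd_fin y : (\int[mu]_(u in `[0%R, y]) (h u + d u)%:E < +oo)%E.
Proof.
under eq_integral do rewrite EFinD.
rewrite ge0_integralD//.
- rewrite lte_add_pinfty ?hazard_fin//.
  have [C dC] := d_bounded y.
  apply: (@le_lt_trans _ _ (\int[mu]_(u in `[0%R, y]) (Num.max C 0)%:E)%E).
    apply: le_integral_ge0 => u; first by rewrite lee_fin.
    move=> uy; have uy' : 0 <= u <= y by move: uy; rewrite /= in_itv.
    by rewrite lee_fin le_max dC.
  rewrite integral_cst//= lebesgue_measure_itv/=.
  by case: ifP => _; rewrite -?EFinD -?EFinM ?mule0 ?ltry.
- by move=> u _; rewrite lee_fin hazard_ge0.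
- by apply/measurable_EFinP; apply: measurable_funTS; exact: measurable_hazard.
- by move=> u _; rewrite lee_fin.
- by apply/measurable_EFinP; exact: measurable_funTS.
Qed.

Let hd_div (A : R) : exists2 y, 0 <= y &
  (A%:E <= \int[mu]_(u in `[0%R, y]) (h u + d u)%:E)%E.
Proof.
have [y y0 Hy] := hazard_div h A; exists y => //.
apply: (le_trans Hy); apply: le_integral_ge0 => u _.
  by rewrite lee_fin hazard_ge0.
by rewrite lee_fin lerDl.
Qed.

Definition hazard_add : hazard := Hazard hd_ge0 measurable_hd hd_fin hd_div.

End hazard_add.
End hazard_construction.

(** * The jump chain *)

Section chain_nonneg.
Context {R : realType} (N : R -> probability (measurableTypeR R) R)
  (Q : R.-pker (measurableTypeR R) ~> (measurableTypeR R)).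
Local Open Scope ereal_scope.

Lemma chain_expectation_ge0 n z (F : n.-tuple (R * R) -> \bar R) :
  (forall s, 0 <= F s) -> 0 <= chain_expectation N Q z F.
Proof.
elim: n z F => [|n IH] z F F0 //=.
by apply: integral_ge0 => y _; apply: integral_ge0 => z' _; exact: IH.
Qed.

Lemma le_chain_expectation n z (F G : n.-tuple (R * R) -> \bar R) :
  (forall s, 0 <= F s) -> (forall s, F s <= G s) ->
  chain_expectation N Q z F <= chain_expectation N Q z G.
Proof.
elim: n z F G => [|n IH] z F G F0 FG //=.
apply: le_integral_ge0 => y _.
  by apply: integral_ge0 => z' _; exact: chain_expectation_ge0.
apply: le_integral_ge0 => z' _; first exact: chain_expectation_ge0.
exact: IH.
Qed.

End chain_nonneg.

Section kernel_snd.
Context d d1 d2 (X : measurableType d) (Y : measurableType d1)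
  (Z : measurableType d2) (R : realType) (k : R.-pker Y ~> Z).

(** The kernel ignores the parameter in [X]. With it an integral against [Q y] of a function that
    also depends on the parameter is measurable jointly in both. *)
Definition kernel_snd (p : X * Y) : {measure set Z -> \bar R} := k p.2.

Let measurable_kernel_snd U : measurable U ->
  measurable_fun setT (kernel_snd ^~ U).
Proof.
move=> mU.
exact: (measurableT_comp (measurable_kernel k U mU) (@measurable_snd _ _ X Y)).
Qed.

HB.instance Definition _ :=
  isKernel.Build _ _ _ _ R kernel_snd measurable_kernel_snd.

Let kernel_snd_prob p : kernel_snd p setT = 1%E.
Proof. exact: prob_kernel. Qed.

HB.instance Definition _ :=
  @Kernel_isProbability.Build _ _ _ _ R kernel_snd kernel_snd_prob.

End kernel_snd.

Section chain_measurable.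
Context {R : realType} (q : R -> @pdf R)
  (Q : R.-pker (measurableTypeR R) ~> (measurableTypeR R)).
Local Notation T := (measurableTypeR R).
Hypothesis mq : measurable_fun setT (fun p : T * T => q p.1 p.2 : T).
Local Notation mu := (@lebesgue_measure R).
Local Open Scope ereal_scope.

Definition pdf_law (z : R) : probability T R := pdf_prob (q z).

(** The laws have a jointly measurable density, so this is an integral against the fixed Lebesgue
    measure and Tonelli applies. *)
Let measurable_integral_pdf d (X : measurableType d) (zeta : X -> T)
    (J : X * T -> \bar R) :
  measurable_fun setT zeta -> measurable_fun setT J -> (forall p, 0 <= J p) ->
  measurable_fun setT (fun x => \int[pdf_law (zeta x)]_y J (x, y)).
Proof.
move=> mzeta mJ J0.
rewrite (_ : (fun x => _) = fubini_F mu (fun p => J p * (q (zeta p.1) p.2)%:E)).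
  apply: measurable_fun_fubini_tonelli_F => /=.
    apply: emeasurable_funM => //; apply/measurable_EFinP.
    apply: (measurableT_comp mq (g := fun p : X * T => (zeta p.1, p.2))).
    by apply: measurable_fun_pair => //; exact: measurableT_comp.
  by move=> p; rewrite mule_ge0// lee_fin pdf_ge0.
apply/funext => x; rewrite /pdf_law integral_pdf_prob//.
by apply: measurableT_comp => //; exact: measurable_pair1.
Qed.

(** The parameter space and the starting point [zeta] are general because the induction moves the
    current jump into the parameter: the hypothesis is used at [(X * T) * T], with the new post-jump
    location as start. *)
Lemma measurable_chain_expectation n d (X : measurableType d) (zeta : X -> T)
    (G : X * n.-tuple (T * T) -> \bar R) :
  measurable_fun setT zeta -> measurable_fun setT G -> (forall p, 0 <= G p) ->
  measurable_fun setT
    (fun x => chain_expectation pdf_law Q (zeta x) (fun s => G (x, s))).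
Proof.
elim: n d X zeta G => [|n IH] d X zeta G mzeta mG G0 /=.
  apply: (measurableT_comp mG (g := fun x : X => (x, [tuple]))).
  exact: measurable_pair2.
pose K (p : (X * T) * T) := chain_expectation pdf_law Q p.2
  (fun s => G (p.1.1, [tuple of (p.1.2, p.2) :: s])).
have K0 p : 0 <= K p by exact: chain_expectation_ge0.
have mK : measurable_fun setT K.
  apply: (IH _ ((X * T) * T)%type snd
    (fun r => G (r.1.1.1, [tuple of (r.1.1.2, r.1.2) :: r.2]))) => //.
  apply: (measurableT_comp mG (g := fun r : ((X * T) * T) * n.-tuple (T * T) =>
    (r.1.1.1, [tuple of (r.1.1.2, r.1.2) :: r.2]))).
  apply: measurable_fun_pair => /=.
    by do 2 apply: measurableT_comp => //.
  apply: measurable_cons => //.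
  apply: measurable_fun_pair; last by apply: measurableT_comp.
  by do 2 apply: measurableT_comp => //.
apply: (@measurable_integral_pdf _ X zeta
  (fun p => \int[Q p.2]_z' K (p, z'))) => //.
  exact: (measurable_fun_integral_sfinite_kernel K
    (kernel_snd (X := X) Q : R.-sfker (X * T)%type ~> T)).
by move=> p; exact: integral_ge0.
Qed.

Lemma measurable_chain_step n (F : n.+1.-tuple (T * T) -> \bar R) :
  measurable_fun setT F -> (forall s, 0 <= F s) ->
  measurable_fun setT (fun p : T * T => chain_expectation pdf_law Q p.2
    (fun s => F [tuple of p :: s])).
Proof.
move=> mF F0.
apply: (@measurable_chain_expectation n _ (T * T)%type snd
  (fun r => F [tuple of r.1 :: r.2])) => //.
apply: (measurableT_comp mF (g := fun r : (T * T) * n.-tuple (T * T) =>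
  [tuple of r.1 :: r.2])).
exact: measurable_cons.
Qed.

Lemma measurable_kernel_step (K : T * T -> \bar R) :
  measurable_fun setT K -> (forall p, 0 <= K p) ->
  measurable_fun setT (fun y => \int[Q y]_z' K (y, z')).
Proof.
move=> mK K0.
exact: (measurable_fun_integral_sfinite_kernel K (Q : R.-sfker T ~> T)).
Qed.

Lemma measurable_tuple_cons n (F : n.+1.-tuple (T * T) -> \bar R) (p : T * T) :
  measurable_fun setT F ->
  measurable_fun setT (fun s : n.-tuple (T * T) => F [tuple of p :: s]).
Proof.
move=> mF.
apply: (measurableT_comp mF (g := fun s : n.-tuple (T * T) => [tuple of p :: s])).
exact: measurable_cons.
Qed.

Lemma chain_expectationD n z (F G : n.-tuple (T * T) -> \bar R) :
  measurable_fun setT F -> (forall s, 0 <= F s) ->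
  measurable_fun setT G -> (forall s, 0 <= G s) ->
  chain_expectation pdf_law Q z (fun s => F s + G s) =
  chain_expectation pdf_law Q z F + chain_expectation pdf_law Q z G.
Proof.
elim: n z F G => [|n IH] z F G mF F0 mG G0 //=.
have mKF := measurable_chain_step mF F0; have mKG := measurable_chain_step mG G0.
under eq_integral => y _.
  under eq_integral => z' _.
    rewrite IH//; [|exact: measurable_tuple_cons..].
    over.
  rewrite ge0_integralD//; last 4 first.
  - by move=> z' _; exact: chain_expectation_ge0.
  - exact: (measurableT_comp mKF (@measurable_pair1 _ _ T T y)).
  - by move=> z' _; exact: chain_expectation_ge0.
  - exact: (measurableT_comp mKG (@measurable_pair1 _ _ T T y)).
  over.
rewrite ge0_integralD//.
- by move=> y _; apply: integral_ge0 => z' _; exact: chain_expectation_ge0.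
- apply: (measurable_kernel_step mKF) => p; exact: chain_expectation_ge0.
- by move=> y _; apply: integral_ge0 => z' _; exact: chain_expectation_ge0.
- apply: (measurable_kernel_step mKG) => p; exact: chain_expectation_ge0.
Qed.

Lemma chain_expectation_sum n z (I : Type) (r : seq I)
    (F : I -> n.-tuple (T * T) -> \bar R) :
  (forall i, measurable_fun setT (F i)) -> (forall i s, 0 <= F i s) ->
  \sum_(i <- r) chain_expectation pdf_law Q z (F i) <=
  chain_expectation pdf_law Q z (fun s => \sum_(i <- r) F i s).
Proof.
move=> mF F0; elim: r => [|i r IH].
  by rewrite big_nil; apply: chain_expectation_ge0 => s; rewrite big_nil.
rewrite big_cons; under [X in _ <= chain_expectation _ _ _ X]eq_fun do rewrite big_cons.
rewrite chain_expectationD//; first exact: leeD2l.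
- by apply: emeasurable_sum.
- by move=> s; apply: sume_ge0.
Qed.

End chain_measurable.

(** * Two-point lower bound along the chain *)

Section two_point.
Context {R : realType} (h0 h1 h2 : @hazard R) (r : R -> R) (rho : R)
  (Q : R.-pker (measurableTypeR R) ~> (measurableTypeR R)).
Local Notation T := (measurableTypeR R).
Local Notation mu := (@lebesgue_measure R).
Local Open Scope ereal_scope.
Hypothesis r_ge0 : forall u, (0 <= r u)%R.
Hypothesis measurable_r : measurable_fun setT (r : T -> T).
Hypothesis h1E : forall u, h1 u = ((1 + r u) * h0 u)%R.
Hypothesis h2E : forall u, h2 u = ((1 + 2 * r u) * h0 u)%R.
Hypothesis rho_ge0 : (0 <= rho)%R.
Hypothesis chi2_le : \int[mu]_u (r u ^+ 2 * h0 u)%:E <= rho%:E.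

Let measurable_first_jump_pdf (h : hazard) (z : R) :
  measurable_fun setT (fun y : T => (first_jump h z y)%:E).
Proof.
by apply/measurable_EFinP; exact: (measurable_pdf (first_jump_pdf h z)).
Qed.

(* The linear weight [th] stands for the likelihood ratio of the jumps already
   observed; the quadratic term comes from [min 1 w >= w - w ^+ 2 / 4]. *)
Lemma two_point_risk n (z th c : R) (F0 F1 : n.-tuple (T * T) -> \bar R) :
  (0 <= th)%R -> (0 <= c)%R ->
  measurable_fun setT F0 -> (forall s, 0 <= F0 s) ->
  measurable_fun setT F1 -> (forall s, 0 <= F1 s) ->
  (forall s, c%:E <= F0 s + F1 s) ->
  (c * th)%:E <= chain_expectation (pdf_law (first_jump_pdf h0)) Q z F0
    + th%:E * chain_expectation (pdf_law (first_jump_pdf h1)) Q z F1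
    + (c * th ^+ 2 * (1 + rho) ^+ n / 4)%:E.
Proof.
elim: n z th F0 F1 => [|n IH] z th F0 F1 th0 c0 mF0 F00 mF1 F10 F01 /=.
  rewrite expr0 mulr1; have := F01 [tuple].
  move: (F00 [tuple]) (F10 [tuple]); move: (F0 _) (F1 _) => a b a0 b0 ab.
  have [th1|th1] := leP th 1%R.
    apply: (@le_trans _ _ (a + th%:E * b)); last first.
      by rewrite leeDl// lee_fin divr_ge0// mulr_ge0// sqr_ge0.
    apply: (@le_trans _ _ (th%:E * (a + b))).
      by rewrite mulrC EFinM lee_wpmul2l// lee_fin.
    rewrite ge0_muleDr// leeD2r//.
    by rewrite -[leRHS]mul1e lee_wpmul2r// lee_fin.
  (* For [th > 1] the two losses already cost [c], and [1 - th + th ^ 2 / 4] is the square of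
     [th / 2 - 1]. *)
  apply: (@le_trans _ _ (c%:E + (c * th ^+ 2 / 4)%:E)).
    rewrite -EFinD lee_fin -subr_ge0.
    rewrite (_ : _ - _ = c * (th / 2 - 1) ^+ 2)%R; last by field.
    by rewrite mulr_ge0// sqr_ge0.
  rewrite leeD2r// (le_trans ab)// leeD2l//.
  by rewrite -[leLHS]mul1e lee_wpmul2r// lee_fin ltW.
pose K0 (p : T * T) := chain_expectation (pdf_law (first_jump_pdf h0)) Q p.2
  (fun s => F0 [tuple of p :: s]).
pose K1 (p : T * T) := chain_expectation (pdf_law (first_jump_pdf h1)) Q p.2
  (fun s => F1 [tuple of p :: s]).
have K00 p : 0 <= K0 p by exact: chain_expectation_ge0.
have K10 p : 0 <= K1 p by exact: chain_expectation_ge0.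
have mK0 : measurable_fun setT K0.
  by apply: measurable_chain_step => //; exact: measurable_first_jump.
have mK1 : measurable_fun setT K1.
  by apply: measurable_chain_step => //; exact: measurable_first_jump.
pose G0 (y : T) := \int[Q y]_z' K0 (y, z').
pose G1 (y : T) := \int[Q y]_z' K1 (y, z').
have G00 y : 0 <= G0 y by exact: integral_ge0.
have G10 y : 0 <= G1 y by exact: integral_ge0.
have mG0 : measurable_fun setT G0 by exact: measurable_kernel_step.
have mG1 : measurable_fun setT G1 by exact: measurable_kernel_step.
pose A := (c * (1 + rho) ^+ n / 4)%R.
have A0 : (0 <= A)%R by rewrite divr_ge0// mulr_ge0// exprn_ge0// addr_ge0.
(* The same [Q] serves both hypotheses, so the post-jump location leaves the weight unchanged; as
   [Q y] is a probability, the induction hypothesis can be integrated with its constant terms. *)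
have stepQ (y : T) (t : R) : (0 <= t)%R ->
    (c * t)%:E <= G0 y + t%:E * G1 y + (t ^+ 2 * A)%:E.
  move=> t0.
  have mK0y := measurableT_comp mK0 (@measurable_pair1 _ _ T T y).
  have mK1y := measurableT_comp mK1 (@measurable_pair1 _ _ T T y).
  rewrite -[leLHS]mule1 -(@prob_kernel _ _ _ _ _ Q y) -integral_cst//.
  rewrite -[X in _ <= _ + X]mule1 -(@prob_kernel _ _ _ _ _ Q y) -integral_cst//.
  rewrite -ge0_integralZl// -!ge0_integralD//; last 5 first.
  - by move=> z' _; rewrite adde_ge0// mule_ge0.
  - by apply: emeasurable_funD => //; exact: measurable_funeM.
  - by move=> z' _; rewrite lee_fin mulr_ge0// sqr_ge0.
  - by move=> z' _; rewrite mule_ge0.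
  - exact: measurable_funeM.
  apply: le_integral_ge0 => z' _; first by rewrite lee_fin mulr_ge0.
  have := IH z' t (fun s => F0 [tuple of (y, z') :: s])
    (fun s => F1 [tuple of (y, z') :: s]) t0 c0.
  rewrite /A (_ : t ^+ 2 * (c * (1 + rho) ^+ n / 4) =
     c * t ^+ 2 * (1 + rho) ^+ n / 4)%R; last by ring.
  by apply => //; exact: measurable_tuple_cons.
(* The weight [th * w] includes the likelihood ratio of the jump to [y]. After multiplication by the
   density under [h0], the terms linear in [w] carry the density under [h1], and the quadratic one
   is bounded by [first_jump_ratio]. *)
have step_mu (y : T) : (c * th)%:E * (first_jump h1 z y)%:E <=
    G0 y * (first_jump h0 z y)%:E + th%:E * (G1 y * (first_jump h1 z y)%:E) +
    (th ^+ 2 * A)%:E * ((first_jump h2 z y)%:E + (r y ^+ 2 * h0 y)%:E).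
  have [q1E q2E] := @first_jump_ratio R h0 h1 h2 r z y r_ge0 h1E h2E.
  move: q1E q2E; set w := (_ * expR _)%R => q1E q2E.
  have w0 : (0 <= w)%R by rewrite mulr_ge0 ?expR_ge0// addr_ge0.
  have q0 := first_jump_ge0 h0 z y.
  have := stepQ y (th * w)%R (mulr_ge0 th0 w0).
  move: q1E q2E q0; set q0 := first_jump h0 z y; set q2 := first_jump h2 z y.
  move=> q1E q2E q00; clearbody w q0 q2.
  move: (G0 y) (G1 y) (G00 y) (G10 y) => a b a0 b0 H.
  rewrite q1E -EFinM (_ : c * th * (w * q0) = c * (th * w) * q0)%R; last by ring.
  have thw0 : (0 <= th * w)%R by rewrite mulr_ge0.
  have tA0 : (0 <= (th * w) ^+ 2 * A)%R by rewrite mulr_ge0// sqr_ge0.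
  rewrite EFinM; apply: (@le_trans _ _
    ((a + (th * w)%:E * b + ((th * w) ^+ 2 * A)%:E) * q0%:E)).
    by rewrite lee_wpmul2r// lee_fin.
  have twb0 : 0 <= (th * w)%:E * b by rewrite mule_ge0.
  rewrite ge0_muleDl ?lee_fin ?adde_ge0// ge0_muleDl//.
  apply: leeD; last first.
    rewrite -EFinM -EFinD -EFinM lee_fin.
    rewrite (_ : (th * w) ^+ 2 * A * q0 = th ^+ 2 * A * (w ^+ 2 * q0))%R;
      last by ring.
    by rewrite ler_wpM2l// mulr_ge0// sqr_ge0.
  rewrite leeD2l// !EFinM -!muleA lee_wpmul2l ?lee_fin//.
  by rewrite muleCA.
rewrite !integral_pdf_prob//.
rewrite (_ : c * th ^+ 2 * (1 + rho) ^+ n.+1 / 4 = th ^+ 2 * A * (1 + rho))%R; last first.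
  by rewrite (exprSr (1 + rho)%R) /A; ring.
have mq2 : measurable_fun setT (fun y : T => (first_jump h2 z y)%:E + (r y ^+ 2 * h0 y)%:E).
  apply: emeasurable_funD => //; apply/measurable_EFinP.
  apply: measurable_funM; last exact: measurable_hazard.
  exact: measurable_funX.
have q20 (y : T) : 0 <= (first_jump h2 z y)%:E + (r y ^+ 2 * h0 y)%:E.
  by rewrite -EFinD lee_fin addr_ge0 ?first_jump_ge0// mulr_ge0 ?sqr_ge0// hazard_ge0.
apply: (@le_trans _ _ (\int[mu]_y ((c * th)%:E * (first_jump h1 z y)%:E))).
  rewrite ge0_integralZl//.
  - by rewrite (integral_pdf (first_jump_pdf h1 z)) mule1.
  - by move=> y _; rewrite lee_fin first_jump_ge0.
  - by rewrite lee_fin mulr_ge0.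
apply: (@le_trans _ _ (\int[mu]_y (
    G0 y * (first_jump h0 z y)%:E + th%:E * (G1 y * (first_jump h1 z y)%:E) +
    (th ^+ 2 * A)%:E * ((first_jump h2 z y)%:E + (r y ^+ 2 * h0 y)%:E)))).
  apply: le_integral_ge0 => y _; last exact: step_mu.
  by rewrite -EFinM lee_fin !mulr_ge0// first_jump_ge0.
have mGq0 : measurable_fun setT (fun y : T => G0 y * (first_jump h0 z y)%:E).
  exact: emeasurable_funM.
have mGq1 : measurable_fun setT (fun y : T => G1 y * (first_jump h1 z y)%:E).
  exact: emeasurable_funM.
have Gq00 (y : T) : 0 <= G0 y * (first_jump h0 z y)%:E.
  by rewrite mule_ge0// lee_fin first_jump_ge0.
have Gq10 (y : T) : 0 <= G1 y * (first_jump h1 z y)%:E.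
  by rewrite mule_ge0// lee_fin first_jump_ge0.
have thA0 : 0 <= (th ^+ 2 * A)%:E by rewrite lee_fin mulr_ge0// sqr_ge0.
rewrite ge0_integralD//; last 4 first.
- by move=> y _; rewrite adde_ge0// mule_ge0.
- by apply: emeasurable_funD => //; exact: measurable_funeM.
- by move=> y _; rewrite mule_ge0.
- exact: measurable_funeM.
rewrite ge0_integralD//; last 2 first.
- by move=> y _; rewrite mule_ge0.
- exact: measurable_funeM.
rewrite !ge0_integralZl//; apply: leeD2l.
(* The density under [h2] has mass 1 and [r ^ 2 * h0] mass at most [rho]: this is the factor
   [1 + rho] of one jump. *)
rewrite [leRHS]EFinM lee_wpmul2l// ge0_integralD//.
- by rewrite (integral_pdf (first_jump_pdf h2 z)) EFinD leeD2l.
- by move=> y _; rewrite lee_fin first_jump_ge0.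
- by move=> y _; rewrite lee_fin mulr_ge0 ?sqr_ge0// hazard_ge0.
- apply/measurable_EFinP; apply: measurable_funM; last exact: measurable_hazard.
  exact: measurable_funX.
Qed.

End two_point.

(** * Assouad's lemma on the cube *)

Section assouad.
Context {R : realType} (K : nat).
Implicit Types (e : {ffun 'I_K -> bool}) (k : 'I_K).

Definition flip k e : {ffun 'I_K -> bool} :=
  [ffun l => if l == k then ~~ e l else e l].

Let flipK k : involutive (flip k).
Proof.
by move=> e; apply/ffunP => l; rewrite !ffunE; case: eqP => // _; rewrite negbK.
Qed.

(** The maximum over the cube is at least the average. For a fixed [k], reindexing by the involution
    [flip k] shows that the sum of the pairs counts each vertex twice, whence [c / 2] per cell on
    average. *)
Let assouad_real (c v : R) (risk : {ffun 'I_K -> bool} -> 'I_K -> R) :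
  (forall e, \sum_k risk e k <= v) ->
  (forall e k, c <= risk e k + risk (flip k e) k) ->
  K%:R * (c / 2) <= v.
Proof.
move=> rv cr; set N := #|{ffun 'I_K -> bool}|.
have N0 : 0 < N%:R :> R.
  by rewrite ltr0n /N; apply/card_gt0P; exists [ffun=> false].
have S1 : \sum_e \sum_k risk e k <= N%:R * v.
  rewrite mulrC mulr_natr -(sumr_const predT v); apply: ler_sum => e _; exact: rv.
have S2 k : N%:R * (c / 2) <= \sum_e risk e k.
  have : \sum_(e : {ffun 'I_K -> bool}) c <= \sum_e (risk e k + risk (flip k e) k).
    by apply: ler_sum => e _; exact: cr.
  have -> : \sum_e (risk e k + risk (flip k e) k) = 2 * \sum_e risk e k.
    rewrite big_split/= [in RHS](reindex_inj (can_inj (flipK k)))/=.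
    rewrite [X in X + _](reindex_inj (can_inj (flipK k)))/=.
    by rewrite mulr2n mulrDl mul1r.
  rewrite sumr_const.
  by rewrite -[c *+ _]mulr_natl -/N; move: (\sum_e _) => S; lra.
have : \sum_(k < K) (N%:R * (c / 2)) <= N%:R * v.
  by apply: le_trans S1; rewrite exchange_big/=; apply: ler_sum => k _; exact: S2.
rewrite sumr_const card_ord -[_ *+ K]mulr_natl mulrCA.
by rewrite ler_pM2l.
Qed.

Lemma assouad (c : R) (V : \bar R) (risk : {ffun 'I_K -> bool} -> 'I_K -> \bar R) :
  (forall e k, 0 <= risk e k)%E ->
  (forall e, \sum_k risk e k <= V)%E ->
  (forall e k, c%:E <= risk e k + risk (flip k e) k)%E ->
  ((K%:R * (c / 2))%:E <= V)%E.
Proof.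
move=> r0 rV cr.
have V0 : (0 <= V)%E by apply: le_trans (rV [ffun=> false]); exact: sume_ge0.
case: V V0 rV => [v| |]// _ rV; last by rewrite leey.
have rfin e k : risk e k \is a fin_num.
  rewrite ge0_fin_numE//; apply: le_lt_trans (ltry v); apply: le_trans (rV e).
  by rewrite (bigD1 k)//= leeDl// sume_ge0.
rewrite lee_fin; apply: (@assouad_real c v (fun e k => fine (risk e k))).
  move=> e; rewrite -lee_fin -sumEFin; apply: le_trans (rV e).
  by under eq_bigr do rewrite fineK//.
by move=> e k; rewrite -lee_fin EFinD !fineK.
Qed.

End assouad.

Lemma normL2_sqr (R : realType) (A : set R) (f : R -> R) :
  (normL A 2 (EFin \o f) ^+ 2 =
   \int[@lebesgue_measure R]_(x in A) (f x ^+ 2)%:E)%E.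
Proof.
have sq (x : \bar R) : (0 <= x -> x ^+ 2 = x `^ 2)%E.
  case: x => [x x0| _|//]; last by rewrite poweRyr// expe2 mulyy.
  by rewrite poweR_EFin powR_mulrn// expe2 -EFinM expr2.
rewrite [RHS]integral_mkcond /normL sq ?Lnorm_ge0//.
rewrite poweR_Lnorm//; apply: eq_integral => x _; rewrite !patchE.
case: ifPn => xA /=; last by rewrite normr0 powR0.
by rewrite powR_mulrn// real_normK ?num_real.
Qed.

(** * Bump functions *)

Section clamped_polynomial.
Context {R : realType}.
Implicit Types (p : {poly R}) (u v x y : R).

Let poly_bounded p : exists2 C : R, 0 <= C &
  forall u, 0 <= u <= 1 -> `|p.[u]| <= C.
Proof.
elim/poly_ind: p => [|p c [C C0 HC]].
  by exists 0 => // u _; rewrite horner0 normr0.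
exists (C + `|c|) => [|u u01]; first by rewrite addr_ge0.
rewrite !hornerE (le_trans (ler_normD _ _))// lerD2r normrM.
have /andP[u0 u1] := u01; rewrite (ger0_norm u0).
by rewrite (le_trans _ (HC u u01))// ler_piMr.
Qed.

(** Induction in Horner form: the remainder of [p * 'X + c] is [v] times that of [p], plus
    [p'(u) * (v - u) ^ 2]. *)
Let poly_taylor p : exists2 C : R, 0 <= C &
  forall u v, 0 <= u <= 1 -> 0 <= v <= 1 ->
    `|p.[v] - p.[u] - (deriv p).[u] * (v - u)| <= C * (v - u) ^+ 2.
Proof.
elim/poly_ind: p => [|p c [C C0 HC]].
  exists 0 => // u v _ _.
  by rewrite deriv0 !horner0 mul0r subrr subr0 normr0 mul0r.
have [B B0 HB] := poly_bounded (deriv p).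
exists (C + B) => [|u v u01 v01]; first by rewrite addr_ge0.
rewrite (_ : _ - _ = v * (p.[v] - p.[u] - (deriv p).[u] * (v - u)) +
    (deriv p).[u] * (v - u) ^+ 2); last first.
  by rewrite derivD derivM derivX derivC !(hornerD, hornerM, hornerX, hornerC); ring.
rewrite (le_trans (ler_normD _ _))// mulrDl lerD//; last first.
  by rewrite normrM (ger0_norm (sqr_ge0 _)) ler_wpM2r ?sqr_ge0// HB.
have /andP[v0 v1] := v01.
by rewrite normrM (ger0_norm v0) (le_trans _ (HC u v u01 v01))// ler_piMl.
Qed.

Definition clamp01 x : R := Num.max 0 (Num.min x 1).

Lemma clamp01_itv x : 0 <= clamp01 x <= 1.
Proof. by rewrite /clamp01 le_max lexx ge_max ler01 ge_min lexx orbT. Qed.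

Lemma clamp01_id x : 0 <= x <= 1 -> clamp01 x = x.
Proof. by move=> /andP[x0 x1]; rewrite /clamp01 min_l// max_r. Qed.

Lemma clamp01_le0 x : x <= 0 -> clamp01 x = 0.
Proof. by move=> x0; rewrite /clamp01 max_l// ge_min x0. Qed.

Lemma clamp01_ge1 x : 1 <= x -> clamp01 x = 1.
Proof. by move=> x1; rewrite /clamp01 min_r// max_r. Qed.

Lemma clamp01_lip x y : `|clamp01 y - clamp01 x| <= `|y - x|.
Proof.
rewrite /clamp01; case: (leP x 1) => ?; case: (leP y 1) => ?;
  rewrite ?(max_r ler01); try case: (leP 0 x) => ?; try case: (leP 0 y) => ?;
  rewrite ler_norml; apply/andP;
  have := ler_norm (y - x); have := ler_norm (x - y); rewrite [`|x - y|]distrC;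
  move: `|y - x| => N; split; lra.
Qed.

Lemma clamped_poly_bounded p : exists2 C : R, 0 <= C &
  forall x, `|p.[clamp01 x]| <= C.
Proof.
by have [C C0 HC] := poly_bounded p; exists C => // x; apply: HC (clamp01_itv x).
Qed.

Lemma clamped_poly_lip p : exists2 C : R, 0 <= C &
  forall x y, `|p.[clamp01 y] - p.[clamp01 x]| <= C * `|y - x|.
Proof.
have [C C0 HC] := poly_taylor p; have [B B0 HB] := poly_bounded (deriv p).
exists (C + B) => [|x y]; first by rewrite addr_ge0.
have xy := clamp01_lip x y.
have u01 := clamp01_itv x; have v01 := clamp01_itv y.
move: (clamp01 x) (clamp01 y) u01 v01 xy => u v u01 v01 xy.
apply: (@le_trans _ _ ((C + B) * `|v - u|)); last by rewrite ler_wpM2l ?addr_ge0.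
rewrite -[_ - _](subrK ((deriv p).[u] * (v - u))) (le_trans (ler_normD _ _))//.
rewrite mulrDl lerD//; last by rewrite normrM ler_wpM2r ?HB.
apply: (le_trans (HC _ _ u01 v01)); rewrite ler_wpM2l//.
rewrite -real_normK ?num_real// expr2 ler_piMl//.
by rewrite ler_norml; apply/andP; move: u01 v01 => /andP[? ?] /andP[? ?]; split; lra.
Qed.

(** The only new error comes from an inner [x] and an outer [y]. There the derivative at [x] is at
    most a constant times the distance from [x] to the end, because it vanishes at the end, and
    [clamp01] moves [y] by at most [y - x] in absolute value: the product is quadratic. *)
Lemma clamped_poly_taylor p : (deriv p).[0] = 0 -> (deriv p).[1] = 0 ->
  exists2 C : R, 0 <= C & forall x y,
    `|p.[clamp01 y] - p.[clamp01 x] - (deriv p).[clamp01 x] * (y - x)|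
      <= C * (y - x) ^+ 2.
Proof.
move=> p0 p1.
have [C C0 HC] := poly_taylor p; have [B B0 HB] := clamped_poly_lip (deriv p).
exists (C + B) => [|x y]; first by rewrite addr_ge0.
rewrite (_ : _ - _ = (p.[clamp01 y] - p.[clamp01 x] -
    (deriv p).[clamp01 x] * (clamp01 y - clamp01 x)) +
  (deriv p).[clamp01 x] * ((clamp01 y - clamp01 x) - (y - x))); last by ring.
rewrite (le_trans (ler_normD _ _))// mulrDl lerD//.
  apply: (le_trans (HC _ _ (clamp01_itv x) (clamp01_itv y))); rewrite ler_wpM2l//.
  by rewrite -[leLHS]real_normK ?num_real// -[leRHS]real_normK ?num_real//
    lerXn2r ?nnegrE// clamp01_lip.
have BB0 : 0 <= B * (y - x) ^+ 2 by rewrite mulr_ge0 ?sqr_ge0.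
have [x0|x0] := leP x 0; first by rewrite (clamp01_le0 x0) p0 mul0r normr0.
have [x1|x1] := leP 1 x; first by rewrite (clamp01_ge1 x1) p1 mul0r normr0.
have x01 : 0 <= x <= 1 by rewrite (ltW x0) (ltW x1).
have [y0|y0] := leP y 0.
  rewrite (clamp01_id x01) (clamp01_le0 y0).
  have := HB 0 x; rewrite (clamp01_id x01) (clamp01_id (x := 0)) ?lexx ?ler01//.
  rewrite p0 subr0 subr0 (gtr0_norm x0) => Hx.
  rewrite normrM (le_trans (ler_wpM2r _ Hx))//.
  rewrite -mulrA ler_wpM2l// ger0_norm; last lra.
  by rewrite expr2; nra.
have [y1|y1] := leP 1 y.
  rewrite (clamp01_id x01) (clamp01_ge1 y1).
  have := HB 1 x; rewrite (clamp01_id x01) (clamp01_id (x := 1)) ?lexx ?ler01//.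
  rewrite p1 subr0 distrC (gtr0_norm (_ : 0 < 1 - x)) ?subr_gt0// => Hx.
  rewrite normrM (le_trans (ler_wpM2r _ Hx))//.
  rewrite -mulrA ler_wpM2l// ler0_norm; last lra.
  by rewrite expr2; nra.
by rewrite !clamp01_id ?(ltW y0) ?(ltW y1)// subrr mulr0 normr0.
Qed.

End clamped_polynomial.

Section spline.
Context {R : realType}.
Variable r : nat.

Let base : {poly R} := 'X * (1 - 'X).

(* [spline j] is the [j]-th derivative of the bump [(x (1 - x)) ^ (r + 1)]
   supported by [0, 1]. *)
Definition spline (j : nat) (x : R) : R := ((derivn j (base ^+ r.+1))).[clamp01 x].

(** Each derivative costs one factor [base], so with the exponent [r.+1] all derivatives of order at
    most [r] vanish at both ends, as extension by zero requires. *)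
Let base_factor j : (j <= r.+1)%N ->
  exists q : {poly R}, (derivn j (base ^+ r.+1)) = base ^+ (r.+1 - j) * q.
Proof.
elim: j => [_|j IH jr]; first by exists 1; rewrite subn0 mulr1.
have [q qE] := IH (ltnW jr).
exists (deriv base * q *+ (r.+1 - j) + base * deriv q).
rewrite derivnS qE derivM deriv_exp.
have -> : (r.+1 - j = (r.+1 - j.+1).+1)%N by rewrite subnS prednK// subn_gt0.
rewrite succnK [base ^+ _.+1]exprS; move: (base ^+ _) => b.
by rewrite mulrDr mulrnAr mulrA !mulrnAl; congr (_ *+ _ + _); ring.
Qed.

Let base0 : base.[0] = 0. Proof. by rewrite /base !hornerE. Qed.
Let base1 : base.[1] = 0. Proof. by rewrite /base !hornerE subrr. Qed.

Let base_derivn0 j u : (j <= r)%N -> base.[u] = 0 ->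
  ((derivn j (base ^+ r.+1))).[u] = 0.
Proof.
move=> jr bu; have [q ->] := base_factor (leqW jr).
by rewrite hornerM horner_exp bu subSn// expr0n mul0r.
Qed.

Lemma spline_out j x : (j <= r)%N -> ~~ (0 < x < 1) -> spline j x = 0.
Proof.
move=> jr; rewrite negb_and -!leNgt => /orP[x0|x1]; rewrite /spline.
  by rewrite clamp01_le0// base_derivn0.
by rewrite clamp01_ge1// base_derivn0.
Qed.

Lemma spline_bounded j : exists2 C : R, 0 <= C & forall x, `|spline j x| <= C.
Proof. exact: clamped_poly_bounded. Qed.

Lemma spline_lip j : exists2 C : R, 0 <= C &
  forall x y, `|spline j y - spline j x| <= C * `|y - x|.
Proof. exact: clamped_poly_lip. Qed.

Lemma spline_taylor j : (j < r)%N -> exists2 C : R, 0 <= C & forall x y,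
  `|spline j y - spline j x - spline j.+1 x * (y - x)| <= C * (y - x) ^+ 2.
Proof.
move=> jr; rewrite /spline; have := @clamped_poly_taylor R (derivn j (base ^+ r.+1)).
by rewrite -derivnS; apply; rewrite base_derivn0.
Qed.

Lemma spline0E x : 0 <= x <= 1 -> spline 0 x = (x * (1 - x)) ^+ r.+1.
Proof. by move=> x01; rewrite /spline derivn0 clamp01_id// !hornerE. Qed.

Lemma spline0_itv x : 0 <= spline 0 x <= 1.
Proof.
rewrite /spline derivn0 !hornerE; have /andP[u0 u1] := clamp01_itv x.
have b0 : 0 <= clamp01 x * (1 - clamp01 x) by rewrite mulr_ge0// subr_ge0.
by rewrite exprn_ge0//= exprn_ile1//; nra.
Qed.

(** On the middle half [x * (1 - x)] is smallest at the ends, where it equals [3 / 16]. *)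
Lemma spline0_ge x : 4^-1 <= x <= 3 / 4 -> (3 / 16) ^+ r.+1 <= spline 0 x.
Proof.
move=> /andP[x0 x1]; rewrite spline0E; last by apply/andP; split; lra.
rewrite lerXn2r ?nnegrE; [by []|lra| |]; nra.
Qed.

Lemma spline_continuous j : continuous (spline j).
Proof.
have [C C0 HC] := spline_lip j.
move=> x; apply/cvgrPdist_lt => e e0.
near=> y; rewrite (le_lt_trans (HC _ _))//.
rewrite (@le_lt_trans _ _ ((C + 1) * `|x - y|))//.
  by rewrite ler_wpM2r// lerDl.
rewrite mulrC -ltr_pdivlMr ?ltr_wpDl//.
by near: y; apply: cvgr_dist_lt; rewrite // divr_gt0// ltr_wpDl.
Unshelve. all: by end_near. Qed.

End spline.

(** * Derivatives and Hoelder norms relative to a set *)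

Section relative_derivative.
Context {R : realType}.
Implicit Types (A : set R) (f g : R -> R) (x y : R).

(* No point of [A] is isolated, so that limits relative to [A] are unique. *)
Definition thick A := forall x, A x -> exists2 c, c != x &
  forall t, 0 <= t <= 1 -> A (x + t * (c - x)).

Lemma thick_proper A x : thick A -> A x -> ProperFilter (within A x^').
Proof.
move=> tA Ax; have [c cx Ac] := tA _ Ax.
apply: Build_ProperFilter_ex => P; rewrite /within/= => /nbhs_ballP[e /= e0 He].
have cx0 : 0 < `|c - x| by rewrite normr_gt0 subr_eq0.
pose t := Num.min 1 (e / (2 * `|c - x|)).
have t0 : 0 < t by rewrite lt_min ltr01 divr_gt0// mulr_gt0.
have t1 : t <= 1 by rewrite ge_min lexx.
exists (x + t * (c - x)); apply: He; last 1 first.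
- by apply: Ac; rewrite (ltW t0).
- rewrite /ball/= opprD addrA subrr sub0r normrN normrM gtr0_norm//.
  apply: (@le_lt_trans _ _ (e / 2)); last by rewrite ltr_pdivrMr// ltr_pMr// ltr1n.
  rewrite -ler_pdivlMr//; first by rewrite -mulrA -invfM ge_min lexx orbT.
- by rewrite -subr_eq0 addrAC subrr add0r mulf_eq0 negb_or gt_eqF//= subr_eq0.
Qed.

Lemma eq_slope_at A f g x : A x -> (forall y, A y -> f y = g y) ->
  forall l : R, slope_at f x y @[y --> within A x^'] --> l ->
  slope_at g x y @[y --> within A x^'] --> l.
Proof.
move=> Ax fg l; apply: cvg_trans; apply: near_eq_cvg; near=> y.
have Ay : A y by near: y; exact: withinT.
by rewrite /slope_at !fg.
Unshelve. all: by end_near. Qed.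

Lemma eq_derivable_in A f g x : A x -> (forall y, A y -> f y = g y) ->
  derivable_in A f x -> derivable_in A g x.
Proof. by move=> Ax fg /cvg_ex[l fl]; apply/cvg_ex; exists l; exact: eq_slope_at fl. Qed.

Lemma eq_deriv_in A f g x : A x -> (forall y, A y -> f y = g y) ->
  deriv_in A f x = deriv_in A g x.
Proof.
move=> Ax fg; rewrite /deriv_in; congr (lim _); apply/seteqP; split => P;
  apply: near_eq_cvg; near=> y;
  by rewrite /slope_at !fg//; near: y; exact: withinT.
Unshelve. all: by end_near. Qed.

Lemma eq_derivn_in A f g k x : A x -> (forall y, A y -> f y = g y) ->
  derivn_in A k f x = derivn_in A k g x.
Proof.
move=> Ax fg; elim: k x Ax => [|k IH] x Ax; first exact: fg.
by rewrite /derivn_in !iterS; apply: eq_deriv_in.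
Qed.

(** A uniform form of [f' = g] on the whole line. It passes to finite sums and rescalings, and gives
    the derivative relative to any set. *)
Definition quadratic_approx f g := exists C : R,
  forall x y, `|f y - f x - g x * (y - x)| <= C * (y - x) ^+ 2.

Lemma quadratic_approx_slope A f g x : quadratic_approx f g ->
  slope_at f x y @[y --> within A x^'] --> g x.
Proof.
move=> [C0 HC0].
have [C C_gt0 HC] : exists2 C : R, 0 < C &
    forall x y, `|f y - f x - g x * (y - x)| <= C * (y - x) ^+ 2.
  exists (`|C0| + 1) => [|u v]; first by rewrite ltr_wpDl.
  rewrite (le_trans (HC0 u v))// ler_wpM2r ?sqr_ge0//.
  by rewrite (le_trans (ler_norm _))// lerDl.
apply/cvgrPdist_lt => e e0.
near=> y; have yx : y != x.
  by near: y; apply: cvg_within; exact: (nbhs_dnbhs_neq (x : R)).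
have yx0 : y - x != 0 by rewrite subr_eq0.
rewrite distrC (_ : _ - _ = (f y - f x - g x * (y - x)) / (y - x)); last first.
  by rewrite /slope_at; field.
rewrite normrM normfV ltr_pdivrMr ?normr_gt0// (le_lt_trans (HC _ _))//.
rewrite -[X in C * X]real_normK ?num_real// expr2 mulrA ltr_pM2r ?normr_gt0//.
rewrite mulrC -ltr_pdivlMr// distrC.
have : ball (x : R) (e / C) y; last by [].
near: y; apply: cvg_within; apply: nbhs_dnbhs.
exact: (nbhsx_ballx (x : R) (e / C) (divr_gt0 e0 C_gt0)).
Unshelve. all: by end_near. Qed.

Lemma derivn_in_add A f (G : nat -> R -> R) r : thick A -> Cr A r f ->
  (forall j, (j < r)%N -> quadratic_approx (G j) (G j.+1)) ->
  forall j x, (j <= r)%N -> A x ->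
    derivn_in A j (f \+ G 0%N) x = derivn_in A j f x + G j x.
Proof.
move=> tA [fr _] Gq; elim => [|j IH] x jr Ax //.
rewrite /derivn_in !iterS -!/(derivn_in _ _ _).
have pA := thick_proper tA Ax.
rewrite (@eq_deriv_in A _ (derivn_in A j f \+ G j))//; last first.
  by move=> y Ay; apply: IH => //; exact: ltnW.
apply: cvg_lim => //.
rewrite [X in X @ _](_ : _ = slope_at (derivn_in A j f) x \+ slope_at (G j) x).
  apply: cvgD; first exact: (fr j jr x Ax).
  by apply: quadratic_approx_slope; exact: Gq.
by apply/funext => y; rewrite /slope_at /= -mulrDl; congr (_ / _); ring.
Qed.

Lemma Cr_add A f (G : nat -> R -> R) r : thick A -> Cr A r f ->
  (forall j, (j < r)%N -> quadratic_approx (G j) (G j.+1)) ->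
  continuous (G r) -> Cr A r (f \+ G 0%N).
Proof.
move=> tA Cf Gq cG; have D := derivn_in_add tA Cf Gq.
have [fr fc] := Cf; split => [k kr x Ax|].
  apply: (@eq_derivable_in A (derivn_in A k f \+ G k)) => //.
    by move=> y Ay; rewrite D//; exact: ltnW.
  have := fr k kr x Ax => /cvg_ex[l fl]; apply/cvg_ex; exists (l + G k.+1 x).
  rewrite [X in X @ _](_ : _ = slope_at (derivn_in A k f) x \+ slope_at (G k) x).
    by apply: cvgD; [exact: fl|apply: quadratic_approx_slope; exact: Gq].
  by apply/funext => y; rewrite /slope_at /= -mulrDl; congr (_ / _); ring.
apply: (@subspace_eq_continuous _ _ _ (derivn_in A r f \+ G r)).
  by move=> x /set_mem Ax; apply/esym/D.
move=> x; apply: cvgD; first exact: fc.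
by apply: continuous_subspaceT.
Qed.

Lemma holder_seminorm_add A f (G : nat -> R -> R) beta (C : R) :
  let r := Num.truncn beta in
  thick A -> A !=set0 -> Cr A r f ->
  (forall j, (j < r)%N -> quadratic_approx (G j) (G j.+1)) ->
  (forall t x y, 0 < t -> `|x - y| <= t ->
    t `^ (r%:R - beta) * `|G r x - G r y| <= C) ->
  (holder_seminorm A beta (f \+ G 0%N)%R <= holder_seminorm A beta f + C%:E)%E.
Proof.
move=> r tA [a Aa] Cf Gq HC.
have D := derivn_in_add tA Cf Gq.
apply: ge_ereal_sup => _ [t t0 ->].
set S := holder_seminorm A beta f.
have tp : 0 < t `^ (r%:R - beta) by rewrite powR_gt0.
rewrite -lee_pdivlMl//; apply: ge_ereal_sup => _ [x [y [Ax Ay xyt ->]]].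
rewrite lee_pdivlMl// !D//.
apply: (@le_trans _ _ ((t `^ (r%:R - beta) *
    `|derivn_in A r f x - derivn_in A r f y|)%:E +
    (t `^ (r%:R - beta) * `|G r x - G r y|)%:E)%E).
  rewrite -EFinM -EFinD lee_fin -mulrDr ler_wpM2l ?(ltW tp)//.
  by rewrite opprD addrACA ler_normD.
apply: leeD; last by rewrite lee_fin HC.
apply: (@le_trans _ _ ((t `^ (r%:R - beta))%:E * modulus A (derivn_in A r f) t)%E).
  rewrite EFinM lee_wpmul2l ?lee_fin ?(ltW tp)//.
  by apply: ereal_sup_ubound; exists x, y.
by apply: ereal_sup_ubound; exists t.
Qed.

Lemma normLy_add A f g (C : R) : A !=set0 -> 0 <= C -> (forall x, `|g x| <= C) ->
  (normL A +oo (EFin \o (f \+ g)%R) <= normL A +oo (EFin \o f) + C%:E)%E.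
Proof.
move=> A0 C0 gC; rewrite /normL unlock.
have [mu0|_] := ltP 0%E _; last by rewrite add0e lee_fin.
apply/ess_supP.
have := ess_sup_ge (@lebesgue_measure R) (abse \o ((EFin \o f) \_ A)).
apply: filterS => x /=; rewrite !patchE; case: ifPn => xA H; last first.
  rewrite abse0 in H *; rewrite adde_ge0 ?lee_fin//.
rewrite /= (le_trans _ (leeD2r _ H))// -EFinD lee_fin.
by rewrite (le_trans (ler_normD _ _))// lerD2l.
Qed.

End relative_derivative.

Section eq_holder.
Context {R : realType} (A : set R) (f g : R -> R).
Hypothesis fg : forall x, A x -> f x = g x.

Lemma eq_Cr r : Cr A r f -> Cr A r g.
Proof.
move=> [fr fc]; split => [k kr x Ax|].
  apply: (eq_derivable_in Ax _ (fr k kr x Ax)) => y Ay; exact: eq_derivn_in.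
apply: subspace_eq_continuous fc => x /set_mem Ax; exact: eq_derivn_in.
Qed.

Lemma eq_holder_seminorm beta : holder_seminorm A beta f = holder_seminorm A beta g.
Proof.
have H k x : A x -> derivn_in A k f x = derivn_in A k g x.
  by move=> Ax; exact: eq_derivn_in.
rewrite /holder_seminorm; congr ereal_sup; apply/seteqP; split => _ [t t0 ->];
  exists t => //; congr (_ * ereal_sup _)%E; apply/seteqP;
  by split => _ [x [y [Ax Ay xyt ->]]]; exists x, y; split; rewrite // !H.
Qed.

Lemma eq_normL p : normL A p (EFin \o f) = normL A p (EFin \o g).
Proof.
rewrite /normL; congr Lnorm; apply/funext => x; rewrite !patchE.
by case: ifPn => // /set_mem Ax /=; rewrite fg.
Qed.

End eq_holder.

Section relative_derivative_continuity.
Context {R : realType} (A : set R).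
Implicit Types (f : R -> R) (x y : R).

Lemma derivable_in_continuous f x : A x -> derivable_in A f x ->
  f y @[y --> within A (nbhs x)] --> f x.
Proof.
move=> Ax /cvg_ex[/= l fl]; apply/cvgrPdist_lt => e e0.
have /cvgrPdist_lt/(_ 1 ltr01) := fl.
move=> /nbhs_ballP[d /= d0 Hd].
have C0 : 0 < `|l| + 1 by rewrite ltr_wpDl.
apply/nbhs_ballP; exists (Num.min d (e / (`|l| + 1))) => /=.
  by rewrite lt_min d0 divr_gt0.
move=> y; rewrite /ball/= lt_min => /andP[xyd xye] Ay.
have [->|yx] := eqVneq y x; first by rewrite subrr normr0.
have := Hd y xyd yx Ay; rewrite /slope_at => H.
have yx0 : 0 < `|y - x| by rewrite normr_gt0 subr_eq0.
have H2 : `|(f y - f x) / (y - x)| < `|l| + 1.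
  rewrite -[X in `|X|](subKr l) (le_lt_trans (ler_normB _ _))// ltrD2l.
  by rewrite distrC in H *.
rewrite distrC -[f y - f x](divfK (_ : y - x != 0)) ?subr_eq0// normrM.
rewrite (lt_trans (_ : _ < (`|l| + 1) * `|y - x|))//; first by rewrite ltr_pM2r.
by rewrite mulrC -ltr_pdivlMr// distrC.
Qed.

Lemma Cr_continuous f r : Cr A r f -> {within A, continuous f}.
Proof.
case: r => [[]//|r [fr _]]; apply/subspace_continuousP => x Ax.
by apply: derivable_in_continuous => //; exact: (fr 0%N).
Qed.

Lemma interval_thick u v : is_interval A -> A u -> A v -> u != v -> thick A.
Proof.
move=> iA Au Av uv x Ax.
have H c : A c -> forall t, 0 <= t <= 1 -> A (x + t * (c - x)).
  move=> Ac t /andP[t0 t1]; have [xc|cx] := leP x c.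
    by apply: (iA x c) => //; apply/andP; split; nra.
  by apply: (iA c x) => //; apply/andP; split; nra.
have [xu|ux] := eqVneq u x; last by exists u => //; exact: H.
by exists v; [rewrite -xu eq_sym|exact: H].
Qed.

Lemma holder_seminorm_ge0 beta f : A !=set0 -> (0 <= holder_seminorm A beta f)%E.
Proof.
move=> [x Ax]; apply: ereal_sup_ge; eexists; first by exists 1; [exact: ltr01|].
rewrite powR1 mul1e; apply: ereal_sup_ge; exists 0%E => //.
by exists x, x; split; rewrite ?subrr ?normr0.
Qed.

End relative_derivative_continuity.

Lemma thickU (R : realType) (A B : set R) : thick A -> thick B -> thick (A `|` B).
Proof.
move=> tA tB x [/tA|/tB] [c cx H]; exists c => // t /H; [by left|by right].
Qed.

(** * Bumps on cells *)

Section cell_bumps.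
Context {R : realType}.
Variables (r K : nat) (i1 h : R).
Hypothesis h_gt0 : 0 < h.
Implicit Types (a x y : R) (e : 'I_K -> bool).

Let pos (k : nat) x : R := (x - i1) / h - k%:R.

(* the [j]-th derivative of a sum of bumps of height at most [a] supported by
   the cells [i1 + k h, i1 + (k + 1) h] selected by [e] *)
Definition cell_bumps a e (j : nat) x : R :=
  \sum_(k < K) (e k)%:R * (a / h ^+ j * spline r j (pos k x)).

Let quadratic_approx_sum (f g : 'I_K -> R -> R) :
  (forall k, quadratic_approx (f k) (g k)) ->
  quadratic_approx (fun x => \sum_(k < K) f k x) (fun x => \sum_(k < K) g k x).
Proof.
move=> fg; have /choice[C HC] := fg.
exists (\sum_(k < K) C k) => x y.
rewrite !mulr_suml -!sumrB (le_trans (ler_norm_sum _ _ _))//.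
by apply: ler_sum => k _; exact: HC.
Qed.

Lemma cell_bumps_approx a e j : (j < r)%N ->
  quadratic_approx (cell_bumps a e j) (cell_bumps a e j.+1).
Proof.
move=> jr; apply: quadratic_approx_sum => k.
have [C C0 HC] := @spline_taylor R r j jr.
exists ((e k)%:R * `|a / h ^+ j| * C / h ^+ 2) => x y.
have hj0 : h ^+ j != 0 by rewrite expf_neq0// gt_eqF.
have h0 : h != 0 by rewrite gt_eqF.
have := HC (pos k x) (pos k y); move: (spline r j _) (spline r j _) (spline r j.+1 _).
move=> b b' d; rewrite (_ : pos k y - pos k x = (y - x) / h); last first.
  by rewrite /pos; field.
move=> H; rewrite (_ : _ - _ = (e k)%:R * (a / h ^+ j) * (b' - b - d * ((y - x) / h))).
  rewrite 2!normrM ger0_norm ?ler0n//.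
  rewrite (_ : _ * (y - x) ^+ 2 = (e k)%:R * `|a / h ^+ j| * (C * ((y - x) / h) ^+ 2)).
    by rewrite ler_wpM2l// mulr_ge0 ?ler0n.
  by rewrite expr_div_n; field.
by rewrite exprS invfM; ring.
Qed.

Lemma cell_bumps_continuous a e j : continuous (cell_bumps a e j).
Proof.
apply: continuous_big => [|k _ x]; first exact: add_continuous.
apply: cvgM; first exact: cvg_cst.
apply: cvgM; first exact: cvg_cst.
apply: (@continuous_comp _ _ _ (pos k) (spline r j)); last exact: spline_continuous.
apply: cvgB; last exact: cvg_cst.
by apply: cvgM; last exact: cvg_cst; apply: cvgB; [exact: cvg_id|exact: cvg_cst].
Qed.

(** The open cells are disjoint: the point [x] determines the only bump that can be active there. *)
Let pos_trunc k x : 0 < pos k x < 1 -> k = Num.truncn ((x - i1) / h).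
Proof.
rewrite /pos => /andP[x0 x1]; apply/esym/truncn_def.
by rewrite -subr_ge0 (ltW x0)/= -natr1 -ltrBlDl.
Qed.

(** The distinguished index [k1] is a natural number since it is computed from a point, which may
    lie beyond the last cell. *)
Let sum_le_one (g : 'I_K -> R) M k1 : 0 <= M -> (forall k, g k <= M) ->
  (forall k : 'I_K, (k : nat) != k1 -> g k <= 0) -> \sum_(k < K) g k <= M.
Proof.
move=> M0 gM g0; have [k1K|Kk1] := ltnP k1 K.
  rewrite (bigD1 (Ordinal k1K))//= -[leRHS]addr0 lerD//.
  by apply: sumr_le0 => k kk; apply: g0; rewrite -val_eqE in kk.
rewrite (le_trans _ M0)//; apply: sumr_le0 => k _; apply: g0.
by rewrite neq_ltn (leq_trans (ltn_ord k)).
Qed.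

(** Meant for increments: between two points only the bumps of the two cells containing them can
    change. *)
Let sum_le_two (g : 'I_K -> R) M k1 k2 : 0 <= M -> (forall k, g k <= M) ->
  (forall k : 'I_K, (k : nat) != k1 -> (k : nat) != k2 -> g k <= 0) ->
  \sum_(k < K) g k <= 2 * M.
Proof.
move=> M0 gM g0; rewrite mulr2n mulrDl !mul1r.
rewrite (bigID (fun k : 'I_K => (k : nat) == k1))/= lerD//.
  rewrite big_mkcond/=; apply: (sum_le_one (k1 := k1)) => // k; first by case: ifP.
  by move=> /negbTE ->.
rewrite big_mkcond/=; apply: (sum_le_one (k1 := k2)) => // k.
  by case: ifP => // _; exact: gM.
by move=> kk2; case: ifP => // kk1; exact: g0.
Qed.

Lemma cell_bumps_itv a e x : 0 <= a -> 0 <= cell_bumps a e 0 x <= a.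
Proof.
move=> a0; rewrite /cell_bumps expr0 divr1; apply/andP; split.
  apply: sumr_ge0 => k _; rewrite !mulr_ge0//.
  by have /andP[] := spline0_itv r (pos k x).
apply: (@sum_le_one _ _ (Num.truncn ((x - i1) / h))) => // k.
  have /andP[b0 b1] := spline0_itv r (pos k x).
  by case: (e k); rewrite ?mul0r// mul1r ler_piMr.
move=> kx; rewrite spline_out ?mulr0//.
by apply: contra_neqN kx => /pos_trunc.
Qed.

Lemma cell_bumps_out a e x : x <= i1 \/ i1 + K%:R * h <= x ->
  cell_bumps a e 0 x = 0.
Proof.
move=> xo; apply: big1 => k _; rewrite [spline _ _ _]spline_out ?mulr0//.
rewrite negb_and -!leNgt /pos; case: xo => xo; apply/orP; [left|right].
  rewrite subr_le0 (@le_trans _ _ 0)// pmulr_lle0 ?invr_gt0//.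
  by rewrite subr_le0.
rewrite lerBrDr nat1r ler_pdivlMr// lerBrDl (le_trans _ xo)// lerD2l.
by rewrite ler_wpM2r ?(ltW h_gt0)// ler_nat ltn_ord.
Qed.

(* Single bumps are the case of an indicator [e]. *)
Lemma cell_bumpsE a e x : cell_bumps a e 0 x =
  \sum_(k < K) (e k)%:R * cell_bumps a (pred1 k) 0 x.
Proof.
rewrite /cell_bumps; apply: eq_bigr => k _; congr (_ * _).
rewrite [in RHS](bigD1 k)//= eqxx mul1r big1 ?addr0// => l lk.
by rewrite (negbTE lk) mul0r.
Qed.

Lemma cell_bump_out a (k : 'I_K) x :
  x <= i1 + k%:R * h \/ i1 + k.+1%:R * h <= x ->
  cell_bumps a (pred1 k) 0 x = 0.
Proof.
move=> xo; apply: big1 => l _ /=; have [->{l}|] := eqVneq l k; last by rewrite mul0r.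
rewrite [spline _ _ _]spline_out ?mulr0//.
rewrite negb_and -!leNgt /pos; case: xo => xo; apply/orP; [left|right].
  by rewrite subr_le0 ler_pdivrMr// lerBlDl.
by rewrite lerBrDr nat1r ler_pdivlMr// lerBrDl.
Qed.

Lemma cell_bump_ge a (k : 'I_K) x : 0 <= a ->
  i1 + (k%:R + 4^-1) * h <= x <= i1 + (k%:R + 3 / 4) * h ->
  a * (3 / 16) ^+ r.+1 <= cell_bumps a (pred1 k) 0 x.
Proof.
move=> a0 /andP[x0 x1].
rewrite /cell_bumps (bigD1 k)//= eqxx mul1r expr0 divr1 big1 ?addr0; last first.
  by move=> l lk; rewrite (negbTE lk) mul0r.
rewrite ler_wpM2l//; apply: spline0_ge; rewrite /pos lerBrDl lerBlDl.
by rewrite ler_pdivlMr// ler_pdivrMr// lerBrDl lerBlDl x0.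
Qed.

Lemma cell_bumps_holder (B C : R) A alpha e t x y :
  0 <= B -> (forall x, `|spline r r x| <= B) ->
  0 <= C -> (forall x y, `|spline r r y - spline r r x| <= C * `|y - x|) ->
  0 <= A -> r%:R <= alpha <= r.+1%:R -> 0 < t -> `|x - y| <= t ->
  t `^ (r%:R - alpha) *
    `|cell_bumps (A * h `^ alpha) e r x - cell_bumps (A * h `^ alpha) e r y|
  <= A * (2 * (2 * B + C + 1)).
Proof.
move=> B0 HB C0 HC A0 /andP[ra ar] t0 xyt.
(* [2 * B] controls a difference of two values, [C] is the Lipschitz constant, and the summand 1
   makes [M] positive. *)
pose M := 2 * B + C + 1; rewrite -/M.
have M0 : 0 < M by rewrite ltr_wpDl// addr_ge0// mulr_ge0.
pose d := Num.min 1 (t / h).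
have d0 : 0 <= d by rewrite le_min ler01 divr_ge0// ltW.
have hr0 : 0 < h ^+ r by rewrite exprn_gt0.
pose a := A * h `^ alpha / h ^+ r.
have a0 : 0 <= a by rewrite !mulr_ge0 ?powR_ge0 ?invr_ge0 ?(ltW hr0).
have H : `|cell_bumps (A * h `^ alpha) e r x - cell_bumps (A * h `^ alpha) e r y|
    <= 2 * (a * (M * d)).
  rewrite /cell_bumps -sumrB (le_trans (ler_norm_sum _ _ _))//.
  apply: (@sum_le_two _ _ (Num.truncn ((x - i1) / h)) (Num.truncn ((y - i1) / h))).
  - by rewrite (mulr_ge0 a0)// mulr_ge0// ltW.
  - move=> k; rewrite -!mulrBr normrM ger0_norm ?ler0n// -/a.
    rewrite (@le_trans _ _ (`|a * (spline r r (pos k x) - spline r r (pos k y))|))//.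
      by rewrite ler_piMl//; case: (e k).
    rewrite normrM (ger0_norm a0) ler_wpM2l//.
    have xy1 : `|spline r r (pos k x) - spline r r (pos k y)| <= M.
      rewrite (le_trans (ler_normB _ _))// (le_trans (lerD (HB _) (HB _)))//.
      by rewrite /M; lra.
    have xy2 : `|spline r r (pos k x) - spline r r (pos k y)| <= M * (t / h).
      rewrite (le_trans (HC _ _))//.
      rewrite (_ : pos k x - pos k y = (x - y) / h); last by rewrite /pos; ring.
      rewrite normrM normfV (gtr0_norm h_gt0) ler_pM ?divr_ge0 ?(ltW h_gt0)//.
        by rewrite /M; lra.
      by rewrite ler_wpM2r// invr_ge0 ltW.
    by rewrite /d; case: (leP 1 (t / h)); rewrite ?mulr1.
  - move=> k kx ky; rewrite !spline_out ?mulr0 ?subrr ?normr0//.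
      by apply: contra_neqN ky => /pos_trunc.
    by apply: contra_neqN kx => /pos_trunc.
(* As [alpha - r] lies between 0 and 1, [min 1 (t / h)] is at most [(t / h) ^ (alpha - r)]. *)
have P : t `^ (r%:R - alpha) * (h `^ alpha / h ^+ r) * d <= 1.
  have s0 : 0 < h / t by rewrite divr_gt0.
  have -> : t `^ (r%:R - alpha) * (h `^ alpha / h ^+ r) = (h / t) `^ (alpha - r%:R).
    rewrite powRM ?invr_ge0 ?(ltW t0) ?(ltW h_gt0)//.
    rewrite [h `^ (alpha - _)]powRB ?(gt_eqF h_gt0) ?implybT// powR_mulrn ?(ltW h_gt0)//.
    by rewrite -[t^-1]powR_inv1 ?(ltW t0)// -powRrM mulN1r opprB mulrC.
  rewrite /d; have [th|th] := leP t h.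
    rewrite (@le_trans _ _ ((h / t) * (t / h)))//; last first.
      by rewrite mulrA divfK ?gt_eqF// divff// gt_eqF.
    rewrite ler_pM ?powR_ge0//.
      rewrite -[leRHS]powRr1 ?(ltW s0)// ler_powR//.
        by rewrite ler_pdivlMr// mul1r.
      by rewrite lerBlDr addrC natr1.
    by rewrite ge_min lexx orbT.
  rewrite -[leRHS]mulr1 ler_pM ?powR_ge0//.
    rewrite -[leRHS](powRr0 (h / t)) ger_powR ?subr_ge0//.
    by rewrite s0 ler_pdivrMr// mul1r ltW.
  by rewrite ge_min lexx.
rewrite (le_trans (ler_wpM2l (powR_ge0 _ _) H))//.
rewrite [leLHS](_ : _ = A * (2 * M) *
    (t `^ (r%:R - alpha) * (h `^ alpha / h ^+ r) * d)).
  by rewrite ler_piMr// mulr_ge0// mulr_ge0// ltW.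
by rewrite /a; ring.
Qed.

(** The middle half of a cell, where the bump stays above a fixed fraction of its height. The cores
    are closed but pairwise disjoint, so their indicators add up to at most 1 at every point. *)
Definition cell_core (k : nat) : set R :=
  `[i1 + (k%:R + 4^-1) * h, i1 + (k%:R + 3 / 4) * h]%classic.

Lemma cell_core_sub (k : 'I_K) : cell_core k `<=` `[i1, i1 + K%:R * h]%classic.
Proof.
move=> x; rewrite /cell_core /= !in_itv/= => /andP[x0 x1]; apply/andP; split.
  rewrite (le_trans _ x0)// lerDl mulr_ge0 ?(ltW h_gt0)// addr_ge0//.
rewrite (le_trans x1)// lerD2l ler_wpM2r ?(ltW h_gt0)//.
have : (k.+1%:R : R) <= K%:R by rewrite ler_nat ltn_ord.
by rewrite -natr1; apply: le_trans; lra.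
Qed.

Lemma sum_cell_core x :
  \sum_(k < K) \1_(cell_core k) x <= \1_(`[i1, i1 + K%:R * h]%classic) x :> R.
Proof.
have [xI|xI] := boolP (x \in `[i1, i1 + K%:R * h]%classic); last first.
  rewrite indicE (negbTE xI) big1// => k _; rewrite indicE.
  by case: (boolP (_ \in _)) => // /set_mem/cell_core_sub/mem_set; rewrite (negbTE xI).
rewrite [leRHS]indicE xI; apply: (@sum_le_one _ _ (Num.truncn ((x - i1) / h))) => // k.
  by rewrite indicE; case: (_ \in _).
rewrite indicE => kx; case: (boolP (_ \in _)) => // /set_mem.
rewrite /cell_core /= in_itv/= => /andP[x0 x1]; case/eqP: kx; apply: pos_trunc.
have -> : pos k x = (x - i1 - k%:R * h) / h.
  by rewrite /pos; field; rewrite gt_eqF.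
have h0 := h_gt0; rewrite mulrDl in x0; rewrite mulrDl in x1.
rewrite divr_gt0//=; last by lra.
by rewrite ltr_pdivrMr//; lra.
Qed.

End cell_bumps.

Lemma cell_bumps_flip (R : realType) r K (i1 h a : R) (e e' : 'I_K -> bool) k x :
  e k = false -> e' k = true -> (forall l, l != k -> e' l = e l) ->
  cell_bumps r i1 h a e' 0 x =
  cell_bumps r i1 h a e 0 x + cell_bumps r i1 h a (pred1 k) 0 x.
Proof.
move=> ek e'k ee'; rewrite (cell_bumpsE _ _ _ _ e') (cell_bumpsE _ _ _ _ e).
rewrite (bigD1 k)//= [in RHS](bigD1 k)//= ek e'k mul1r mul0r add0r addrC.
by congr (_ + _); apply: eq_bigr => l lk; rewrite ee'.
Qed.

Section perturbed_holder.
Context {R : realType} (alpha : R).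
Let r := Num.truncn alpha.
Hypothesis alpha_gt0 : 0 < alpha.

(* The [r]-th derivative of the bumps varies by at most a constant times
   [A h ^ (alpha - r) min (1, t / h)] over a distance [t], whence a bound free of
   [h] and [K]. *)
Lemma perturbed_holder_norm : exists2 C : R, 0 < C &
  forall (J : set R) (lam0 : R -> R) (K : nat) (i1 h A : R) (e : 'I_K -> bool),
    thick J -> J !=set0 -> 0 < h -> 0 <= A -> holder J alpha lam0 ->
    let beta := cell_bumps r i1 h (A * h `^ alpha) e 0 in
    holder J alpha (lam0 \+ beta) /\
    (holder_norm J alpha (lam0 \+ beta)%R <=
     holder_norm J alpha lam0 + (A * C + A * h `^ alpha)%:E)%E.
Proof.
have [B B0 HB] := @spline_bounded R r r; have [C C0 HC] := @spline_lip R r r.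
exists (2 * (2 * B + C + 1)) => [|J lam0 K i1 h A e tJ J0 h0 A0 [Clam0 slam0] beta].
  by rewrite mulr_gt0// ltr_wpDl// addr_ge0// mulr_ge0.
set M := 2 * (2 * B + C + 1).
pose G := cell_bumps r i1 h (A * h `^ alpha) e.
have Gq j : (j < r)%N -> quadratic_approx (G j) (G j.+1).
  by move=> jr; exact: cell_bumps_approx.
have Ha : r%:R <= alpha <= r.+1%:R.
  have /andP[-> /ltW] := truncn_itv (ltW alpha_gt0).
  by rewrite /r.
have sb : (holder_seminorm J alpha (lam0 \+ beta)%R <=
    holder_seminorm J alpha lam0 + (A * M)%:E)%E.
  apply: (holder_seminorm_add tJ J0 Clam0 Gq) => t x y t0 xyt.
  exact: cell_bumps_holder.
have nb : (normL J +oo (EFin \o (lam0 \+ beta)%R) <=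
    normL J +oo (EFin \o lam0) + (A * h `^ alpha)%:E)%E.
  have a0 : 0 <= A * h `^ alpha by rewrite mulr_ge0// powR_ge0.
  apply: normLy_add => // x.
  have /andP[b0 b1] := @cell_bumps_itv R r K i1 h (A * h `^ alpha) e x a0.
  by rewrite ger0_norm.
split; first split.
- apply: (Cr_add tJ Clam0 Gq); exact: cell_bumps_continuous.
- by rewrite (le_lt_trans sb)// lte_add_pinfty ?ltry.
by rewrite /holder_norm EFinD addeACA leeD.
Qed.

End perturbed_holder.

(** * The flow and the domain of the rates *)

Lemma RplusE (R : realType) : @Rplus R = `[0, +oo[%classic.
Proof. by apply/seteqP; split => x /=; rewrite in_itv/= andbT. Qed.

Section rate_domain.
Context {R : realType} (i1 i2 : R) (jQ : nat) (f : nat -> R -> R).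

Lemma Jset_sub k : `[i1, i2]%classic `<=` Jset i1 i2 jQ f k.
Proof.
by case: k => [//|k] /=; apply: sub_smallest => x ?; left.
Qed.

Lemma is_interval_Jset k : is_interval (Jset i1 i2 jQ f k).
Proof.
case: k => [|k] /=; first exact: interval_is_interval.
set G := _ `|` _ => x y Gx Gy z /andP[xz zy] A [cA GA].
have [xy|yx] := ltP x y; last first.
  have <- : x = z by apply/le_anti; rewrite xz (le_trans zy yx).
  exact: (Gx A (conj cA GA)).
have xy0 : 0 < y - x by rewrite subr_gt0.
have t01 : 0 <= (y - z) / (y - x) <= 1.
  rewrite divr_ge0 ?subr_ge0 ?(ltW xy)//= ler_pdivrMr// mul1r.
  by rewrite lerD2l lerN2.
have /andP[t0 t1] := t01.
pose t : {i01 R} := Itv01 t0 t1.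
have : A ((y - z) / (y - x) * x + (1 - (y - z) / (y - x)) * y).
  exact: set_mem (cA x y t (mem_set (Gx A (conj cA GA))) (mem_set (Gy A (conj cA GA)))).
by rewrite (_ : _ * x + _ = z)//; field; rewrite gt_eqF.
Qed.

End rate_domain.

Section flow.
Context {R : realType} (phi : R -> R -> R).
Hypothesis phiP : is_flow phi.
Local Notation clock := ('pinv_(fun=> (0 : R)) Rplus (phi 0)).

Let flow_pinv x t : 0 <= x -> 0 <= t ->
  'pinv_(fun=> 0) Rplus (phi x) (phi x t) = t.
Proof.
move=> x0 t0; have [_ _ _ /(_ x x0) [[_ inj _] _ _ _]] := phiP.
by apply: pinvKV => //; apply/mem_set.
Qed.

Let flow_surj x y : 0 <= x -> x <= y -> exists2 t, 0 <= t & phi x t = y.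
Proof.
move=> x0 xy; have [_ _ _ /(_ x x0) [[_ _ surj] _ _ _]] := phiP.
by have [|t t0 <-] := surj y; [rewrite /= in_itv/= xy|exists t].
Qed.

(* The semigroup property makes every flow line a piece of the one from [0]. *)
Lemma flow_inv_clock x y : 0 <= x -> 0 <= y ->
  flow_inv phi x y = clock y - clock x.
Proof.
have [_ _ semi _] := phiP.
suff H u v : 0 <= u -> u <= v ->
    'pinv_(fun=> 0) Rplus (phi u) v = clock v - clock u.
  move=> x0 y0; rewrite /flow_inv; case: ifPn => [xy|]; first exact: H.
  by rewrite -ltNge => /ltW yx; rewrite H// opprB.
move=> u0 uv.
have [s s0 su] := flow_surj (lexx 0) u0.
have [t t0 tv] := flow_surj u0 uv.
rewrite -tv flow_pinv// -su -semi// !flow_pinv ?addr_ge0//.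
by rewrite addrK.
Qed.

Lemma dflow_inv_clock x y : 0 <= x -> 0 <= y ->
  dflow_inv phi x y = deriv_in Rplus clock y.
Proof.
move=> x0 y0; rewrite /dflow_inv (@eq_deriv_in _ _ _ (fun v => clock v - clock x))//.
  rewrite /deriv_in (_ : slope_at _ y = slope_at clock y)//; apply/funext => v.
  by rewrite /slope_at opprB addrA subrK.
by move=> v v0; exact: flow_inv_clock.
Qed.

Lemma clock_deriv_continuous : {within Rplus, continuous (deriv_in Rplus clock)}.
Proof.
have [_ _ _ /(_ 0 (lexx 0)) [_ _ _ [_]]] := phiP.
by rewrite -RplusE.
Qed.

Lemma measurable_flow x : 0 <= x -> measurable_fun Rplus (phi x).
Proof.
move=> x0; have [_ _ _ /(_ x x0) [_ inc _ _]] := phiP.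
pose psi s := phi x (Num.max 0 s).
have psi_nd : {homo psi : s t / s <= t}.
  move=> s t st; have : Num.max 0 s <= Num.max 0 t by rewrite le_max2.
  rewrite le_eqVlt => /predU1P[|lt]; first by rewrite /psi => ->.
  by apply/ltW/inc => //; apply/mem_set; rewrite /Rplus/= le_max lexx.
apply: (@eq_measurable_fun _ _ _ _ _ psi).
  by move=> s /set_mem s0; rewrite /psi max_r.
by apply: nondecreasing_measurable => //; rewrite RplusE.
Qed.

End flow.

Section final_domain.
Context {R : realType} (i1 i2 kappa a b alpha : R) (jQ : nat) (f : nat -> R -> R).
Hypothesis i12 : i1 < i2.
Let J := Jfinal i1 i2 kappa a b alpha jQ f.

Let i2'_ge : i2 <= i2' i1 i2 kappa a b.
Proof. by rewrite /i2' le_max lexx. Qed.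

Lemma Jfinal_sub : `[i1, i2]%classic `<=` J.
Proof. by move=> x xI; left; exact: Jset_sub. Qed.

Lemma measurable_Jfinal : measurable (J : set (measurableTypeR R)).
Proof.
apply: measurableU; last exact: measurable_itv.
apply: is_interval_measurable; exact: is_interval_Jset.
Qed.

Lemma Jfinal_thick : thick J.
Proof.
have i1I : `[i1, i2]%classic i1 by rewrite /= in_itv/= lexx ltW.
have i2I : `[i1, i2]%classic i2 by rewrite /= in_itv/= lexx ltW.
have ne : i1 != i2 by rewrite lt_eqF.
apply: thickU.
  apply: (@interval_thick _ _ i1 i2) => //; [exact: is_interval_Jset|exact: Jset_sub..].
apply: (@interval_thick _ _ i1 i2) => //; first exact: interval_is_interval.
  by rewrite /= in_itv/= lexx (le_trans (ltW i12)).
by rewrite /= in_itv/= (ltW i12).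
Qed.

End final_domain.

(** * The rates indexed by the cube *)

Section rates.
Context {R : realType} (phi : R -> R -> R) (m M : R -> R)
  (i1 i2 a b l L alpha : R) (J : set R) (lam0 lam : R -> R).
Local Notation mu := (@lebesgue_measure R).
Local Notation T := (measurableTypeR R).
Let g := deriv_in Rplus ('pinv_(fun=> (0 : R)) Rplus (phi 0)).
Hypothesis i1_gt0 : 0 < i1.
Hypothesis i12 : i1 < i2.
Hypothesis phiP : is_flow phi.
Hypothesis mM : condS2 phi m M.
Hypothesis a_gt0 : 0 < a.
Hypothesis b_gtN1 : -1 < b.
Hypothesis lamP : is_jump_rate phi lam.
Hypothesis lam_lb : rate_lower_bound i1 a b m lam.
Hypothesis lam_bd : forall y, exists C, forall u, i1 <= u <= y -> lam u <= C.
Hypothesis lam0P : is_jump_rate phi lam0.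
Hypothesis lam0_lb : rate_lower_bound i1 a b m lam0.
Hypothesis lam0_early : (early_hazard i1 M lam0 <= l%:E)%E.
Hypothesis lam0_bd : (normL J +oo (EFin \o lam0) < +oo)%E.
Hypothesis Ji1 : J i1.
Hypothesis mJ : measurable (J : set T).

Let bp1 : 0 < b + 1. Proof. by rewrite -ltrBlDr sub0r. Qed.

Lemma clock_deriv_bounds y : 0 <= y -> [/\ 0 < m y, m y <= g y & g y <= M y].
Proof.
move=> y0; have [? ? ?] := mM (lexx 0) y0.
by rewrite /g -(dflow_inv_clock phiP (lexx 0) y0).
Qed.

Lemma clock_deriv_gt0 y : 0 <= y -> 0 < g y.
Proof. by move=> /clock_deriv_bounds[m0 mg _]; exact: lt_le_trans mg. Qed.

Lemma clock_deriv_bounded y : exists2 C, 0 < C & forall u, 0 <= u <= y -> g u <= C.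
Proof.
have [y0|y0] := ltP y 0.
  by exists 1 => // u /andP[u0 uy]; have := lt_le_trans y0 (le_trans u0 uy); rewrite ltxx.
have [|c c0y Hc] := @EVT_max R g 0 y y0.
  apply: continuous_subspaceW (clock_deriv_continuous phiP) => u /=.
  by rewrite in_itv/= => /andP[].
exists (g c) => [|u uy]; last by apply: Hc; rewrite in_itv.
by apply: clock_deriv_gt0; move: c0y; rewrite in_itv/= => /andP[].
Qed.

Lemma measurable_clock_deriv : measurable_fun (Rplus : set T) (g : T -> T).
Proof.
apply: subspace_continuous_measurable_fun; first by rewrite RplusE.
exact: clock_deriv_continuous.
Qed.

(* Outside [J] the class prescribes no regularity, so [lam0] is replaced there
   by the rate [lam], which is Hoelder on compact sets. *)
Definition base_rate (x : R) : R :=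
  if x \in J `|` [set x | x < i1] then lam0 x else lam x.

Lemma base_rateE x : J x \/ x < i1 -> base_rate x = lam0 x.
Proof. by move=> H; rewrite /base_rate mem_set. Qed.

Lemma base_rate_ge0 x : 0 <= x -> 0 <= base_rate x.
Proof.
by move=> x0; rewrite /base_rate; case: ifP => _; [case: lam0P|case: lamP] => + _ _; apply.
Qed.

Lemma base_rate_le x : 0 <= x -> base_rate x <= lam0 x + lam x.
Proof.
move=> x0; rewrite /base_rate; have [l0 _ _] := lamP; have [l00 _ _] := lam0P.
by case: ifP => _; [rewrite lerDl l0|rewrite lerDr l00].
Qed.

Lemma measurable_base_rate : measurable_fun (Rplus : set T) (base_rate : T -> T).
Proof.
pose S : set T := J `|` [set x | x < i1].
have mS : measurable S.
  apply: measurableU => //; rewrite (_ : [set x | x < i1] = `]-oo, i1[%classic)//.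
apply: (@eq_measurable_fun _ _ _ _ _ (fun x : T => \1_S x * lam0 x + \1_(~` S) x * lam x)).
  move=> x _; rewrite /base_rate -/S !indicE in_setC.
  by case: ifPn => xS; rewrite ?mul1r ?mul0r ?addr0 ?add0r.
have [_ ml0 _] := lam0P; have [_ ml _] := lamP.
apply: measurable_funD; apply: measurable_funM => //; apply: measurable_indic => //.
exact: measurableC.
Qed.

Lemma base_rate_lower_bound : rate_lower_bound i1 a b m base_rate.
Proof. by move=> y y1; rewrite /base_rate; case: ifP => _; [exact: lam0_lb|exact: lam_lb]. Qed.

Lemma base_rate_early : (early_hazard i1 M base_rate <= l%:E)%E.
Proof.
rewrite (_ : early_hazard i1 M base_rate = early_hazard i1 M lam0)//.
apply: eq_integral => u; rewrite inE/= in_itv/= => /andP[_].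
by rewrite le_eqVlt => /predU1P[->|ui]; rewrite base_rateE//; [left|right].
Qed.

Let base_haz : R -> R := (fun u => base_rate u * g u) \_ Rplus.

Let base_hazE u : 0 <= u -> base_haz u = base_rate u * g u.
Proof. by move=> u0; rewrite /base_haz patchE mem_set. Qed.

Let base_haz_ge0 u : 0 <= base_haz u.
Proof.
rewrite /base_haz patchE; case: ifPn => // /set_mem u0.
by rewrite mulr_ge0 ?base_rate_ge0// ltW// clock_deriv_gt0.
Qed.

Let measurable_base_haz : measurable_fun setT (base_haz : T -> T).
Proof.
apply/(measurable_restrictT _ _).1; first by rewrite RplusE.
by apply: measurable_funM; [exact: measurable_base_rate|exact: measurable_clock_deriv].
Qed.

Let base_haz_lb y : i1 <= y -> a * y `^ b / (b + 1) <= base_haz y.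
Proof.
move=> y1; have y0 : 0 <= y by rewrite (le_trans _ y1)// ltW.
rewrite base_hazE// (le_trans (base_rate_lower_bound y1))//.
by rewrite ler_wpM2l ?base_rate_ge0//; have [] := clock_deriv_bounds y0.
Qed.

Let base_haz_div (A : R) : exists2 y, 0 <= y &
  (A%:E <= \int[mu]_(u in `[0%R, y]) (base_haz u)%:E)%E.
Proof.
(* Since [b > -1], [u ^ b >= 1 / u] for [u >= 1], which explains the threshold [Num.max i1 1]. *)
apply: (@integral_inv_diverges _ base_haz (a / (b + 1)) (Num.max i1 1)) => //.
- by rewrite divr_gt0.
- by rewrite lt_max i1_gt0.
move=> u; rewrite ge_max => /andP[u1 u2].
rewrite (le_trans _ (base_haz_lb u1))// [leRHS]mulrAC ler_wpM2l//.
  by rewrite divr_ge0// ltW.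
by rewrite -powR_inv1 ?(le_trans ler01)// ler_powR// ltW.
Qed.

(** Below [i1] the bound on [early_hazard] applies, as [g <= M]. Above [i1], [g] is bounded on
    compacts, and the rate is bounded by the norm of [lam0] on [J] and by the local bound of [lam]
    outside [J]. *)
Let base_haz_fin y : (\int[mu]_(u in `[0%R, y]) (base_haz u)%:E < +oo)%E.
Proof.
have mb (D : set T) : measurable_fun D (fun u : T => (base_haz u)%:E).
  by apply/measurable_EFinP; exact: measurable_funTS.
pose y1 := Num.max y i1.
apply: (@le_lt_trans _ _ (\int[mu]_(u in `[0%R, y1]) (base_haz u)%:E)%E).
  apply: ge0_subset_integral => //=; first by move=> u _; rewrite lee_fin.
  by move=> u /=; rewrite !in_itv/= => /andP[-> uy]; rewrite le_max uy.
have i1y1 : i1 <= y1 by rewrite le_max lexx orbT.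
rewrite (@itv_bndbnd_setU _ _ (BLeft 0) (BRight i1) (BRight y1)) ?bnd_simp ?(ltW i1_gt0)//.
rewrite ge0_integral_setU//=; last 2 first.
- by move=> u _; rewrite lee_fin.
- apply/disj_set2P; rewrite -subset0 => z/=; rewrite !in_itv/= => -[/andP[_]].
  by rewrite leNgt => /negbTE ->.
apply: lte_add_pinfty.
  apply: (@le_lt_trans _ _ l%:E); last exact: ltry.
  apply: le_trans base_rate_early; apply: le_integral_ge0 => u.
    by rewrite lee_fin.
  rewrite /= in_itv/= => /andP[u0 ui].
  rewrite lee_fin base_hazE// ler_wpM2l ?base_rate_ge0//.
  by have [] := clock_deriv_bounds u0.
have [C HC] := lam_bd y1; have [G G0 HG] := clock_deriv_bounded y1.
(* The norm is an essential supremum, so [lam0] is bounded on [J] only almost everywhere and the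
   integrals are compared almost everywhere. *)
have [L' HL'] : exists L' : R, {ae mu, forall x, J x -> lam0 x <= L'}.
  have muT : (0 < mu setT)%E by rewrite -set_itvNyy lebesgue_measure_itv /= ltry.
  move: lam0_bd; rewrite /normL unlock muT => Hlt.
  exists (fine (ess_sup mu (abse \o ((EFin \o lam0) \_ J)))).
  have := ess_sup_ge mu (abse \o ((EFin \o lam0) \_ J)).
  apply: filterS => x /= Hx Jx.
  move: Hx Hlt; rewrite patchE mem_set//=; case: (ess_sup _ _) => [s| |]//=.
  by rewrite lee_fin => Hx _; exact: le_trans (ler_norm _) Hx.
pose B := Num.max (Num.max L' C) 0 * G.
apply: (@le_lt_trans _ _ (\int[mu]_(u in `]i1, y1]) B%:E)%E); last first.
  rewrite integral_cst//= lebesgue_measure_itv/=.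
  by case: ifP => _; rewrite -?EFinD -?EFinM ?mule0 ?ltry.
apply: ae_ge0_le_integral => //.
- by move=> u _; rewrite lee_fin.
- by move=> u _; rewrite lee_fin mulr_ge0 ?(ltW G0)// le_max lexx orbT.
have [N [mN N0 HN]] := HL'; exists N; split => // u; apply: contra_notP => Nu.
have {}Hu : J u -> lam0 u <= L' by apply: contrapT => /HN.
rewrite /= in_itv/= => /andP[iu uy].
have u0 : 0 <= u by rewrite ltW// (lt_trans i1_gt0).
rewrite lee_fin base_hazE// ler_pM ?base_rate_ge0//.
- by rewrite ltW// clock_deriv_gt0.
- rewrite /base_rate; case: ifPn => [/set_mem[Ju|/= ui]|_].
  + by rewrite !le_max Hu.
  + by have := lt_trans iu ui; rewrite ltxx.
  + by rewrite !le_max HC ?orbT// (ltW iu).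
- by apply: HG; rewrite u0.
Qed.

Definition base_hazard : hazard :=
  Hazard base_haz_ge0 measurable_base_haz base_haz_fin base_haz_div.

Section perturbation.
Variables (beta : R -> R) (B : R).
Hypothesis beta_ge0 : forall x, 0 <= beta x.
Hypothesis beta_le : forall x, beta x <= B.
Hypothesis beta_continuous : continuous beta.
Hypothesis beta_out : forall x, x <= i1 \/ i2 <= x -> beta x = 0.

Let measurable_beta : measurable_fun setT (beta : T -> T).
Proof. exact: continuous_measurable_fun. Qed.

Let beta_haz : R -> R := (fun u => beta u * g u) \_ Rplus.

Let beta_haz_ge0 u : 0 <= beta_haz u.
Proof.
rewrite /beta_haz patchE; case: ifPn => // /set_mem u0.
by rewrite mulr_ge0// ltW// clock_deriv_gt0.
Qed.

Let measurable_beta_haz : measurable_fun setT (beta_haz : T -> T).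
Proof.
apply/(measurable_restrictT _ _).1; first by rewrite RplusE.
apply: measurable_funM; last exact: measurable_clock_deriv.
exact: measurable_funTS.
Qed.

Let beta_haz_bounded y : exists C, forall u, 0 <= u <= y -> beta_haz u <= C.
Proof.
have [G G0 HG] := clock_deriv_bounded y; exists (B * G) => u /andP[u0 uy].
rewrite /beta_haz patchE mem_set// ler_pM//; last by rewrite HG// u0.
by rewrite ltW// clock_deriv_gt0.
Qed.

Definition rate_hazard : hazard :=
  hazard_add base_hazard beta_haz_ge0 measurable_beta_haz beta_haz_bounded.

Lemma rate_hazardE u :
  rate_hazard u = if u \in Rplus then (base_rate u + beta u) * g u else 0.
Proof.
rewrite /rate_hazard/= /base_haz /beta_haz !patchE; case: ifP => _.
  by rewrite mulrDl.
by rewrite addr0.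
Qed.

Lemma rate_prejump_law :
  prejump_law phi (base_rate \+ beta) (pdf_law (first_jump_pdf rate_hazard)).
Proof.
move=> z y z0 zy; rewrite [LHS](first_jump_tail rate_hazard z0 zy).
congr (expeR (- _)).
apply: eq_integral => u /set_mem; rewrite [_ u]/= in_itv => /andP[zu uy].
have u0 := le_trans z0 zu.
by rewrite rate_hazardE mem_set//= dflow_inv_clock.
Qed.

(** The bound [lam0 + lam] on the spliced rate gives integrability along the flow however the flow
    line crosses the pieces. *)
Lemma perturbed_jump_rate : is_jump_rate phi (base_rate \+ beta).
Proof.
split=> [x x0||x x0] /=.
- by rewrite addr_ge0// base_rate_ge0.
- apply: measurable_funD; first exact: measurable_base_rate.
  exact: measurable_funTS.
have [l0 ml /(_ x x0) [e1 e10 He1]] := lamP.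
have [l00 ml0 /(_ x x0) [e2 e20 He2]] := lam0P.
have mphi := measurable_flow phiP x0.
have phi_ge0 s : 0 <= s -> 0 <= phi x s.
  move=> s0; have [_ _ _ /(_ x x0) [[img _ _] _ _ _]] := phiP.
  have := img s s0; rewrite /= in_itv/= andbT; exact: le_trans.
pose e := Num.min e1 e2; exists e; first by rewrite lt_min e10.
have sub0 : `[0, e]%classic `<=` @Rplus R.
  by move=> s; rewrite /= in_itv/= => /andP[].
have mcomp (k : R -> R) : measurable_fun (Rplus : set T) (k : T -> T) ->
    measurable_fun (`[0, e]%classic : set T) (fun s : T => (k (phi x s))%:E).
  move=> mk; apply/measurable_EFinP.
  apply: (@measurable_comp _ _ _ _ _ _ (Rplus : set T) (k : T -> T) _ (phi x : T -> T)).
  - by rewrite RplusE.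
  - by move=> _ /= [s /sub0 s0 <-]; exact: phi_ge0.
  - exact: mk.
  - by apply: measurable_funS mphi => //; rewrite RplusE.
have small (k : R -> R) e' : e <= e' -> (forall y, 0 <= y -> 0 <= k y) ->
    (\int[mu]_(s in `[0%R, e']) (k (phi x s))%:E < +oo)%E ->
    (\int[mu]_(s in `[0%R, e]) (k (phi x s))%:E < +oo)%E.
  move=> ee' k0; apply: le_lt_trans.
  rewrite [leLHS]integral_mkcond [leRHS]integral_mkcond.
  apply: le_integral_ge0 => s _.
    by apply: erestrict_ge0 => t /sub0 t0; rewrite lee_fin k0// phi_ge0.
  rewrite !patchE; case: ifPn => [/set_mem|_].
    rewrite /= in_itv/= => /andP[s0 se]; rewrite mem_set//= in_itv/= s0.
    exact: le_trans ee'.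
  case: ifPn => // /set_mem; rewrite /= in_itv/= => /andP[s0 _].
  by rewrite lee_fin k0// phi_ge0.
apply: (@le_lt_trans _ _ (\int[mu]_(s in `[0%R, e])
    ((lam0 (phi x s))%:E + (lam (phi x s))%:E + B%:E))%E).
  apply: le_integral_ge0 => s; rewrite /= in_itv/= => /andP[s0 se].
    by rewrite lee_fin addr_ge0// base_rate_ge0// phi_ge0.
  by rewrite -!EFinD lee_fin lerD// base_rate_le// phi_ge0.
have B0 : 0 <= B := le_trans (beta_ge0 0) (beta_le 0).
rewrite ge0_integralD//; last 2 first.
- move=> s /sub0 s0; rewrite -EFinD lee_fin addr_ge0//.
  + by rewrite l00// phi_ge0.
  + by rewrite l0// phi_ge0.
- by apply: emeasurable_funD; exact: mcomp.
rewrite ge0_integralD//; last 4 first.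
- by move=> s /sub0 s0; rewrite lee_fin l00// phi_ge0.
- exact: mcomp.
- by move=> s /sub0 s0; rewrite lee_fin l0// phi_ge0.
- exact: mcomp.
apply: lte_add_pinfty; first apply: lte_add_pinfty.
- by apply: small He2 => //; rewrite ge_min lexx orbT.
- by apply: small He1 => //; rewrite ge_min lexx.
rewrite integral_cst//= lebesgue_measure_itv/=.
by case: ifP => _; rewrite -?EFinD -?EFinM ?mule0 ?ltry.
Qed.

(** The Hoelder norm sees only [J], where the spliced rate is [lam0]; the bumps are nonnegative,
    which keeps the lower bound, and vanish up to [i1], which keeps the early hazard. *)
Lemma perturbed_rate_class :
  holder J alpha (lam0 \+ beta) ->
  (holder_norm J alpha (lam0 \+ beta)%R <= L%:E)%E ->
  rate_class phi m M i1 J a l L b alpha (base_rate \+ beta).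
Proof.
have E x : J x -> (lam0 \+ beta) x = (base_rate \+ beta) x.
  by move=> Jx /=; rewrite base_rateE//; left.
move=> [hC hS] hN; split; first exact: perturbed_jump_rate.
split.
- split; first exact: eq_Cr hC.
  by rewrite -(eq_holder_seminorm E).
- move=> y y1 /=; rewrite (le_trans (base_rate_lower_bound y1))//.
  have [m0 _ _] := clock_deriv_bounds (le_trans (ltW i1_gt0) y1).
  by rewrite ler_wpM2r ?(ltW m0)// lerDl.
- apply: le_trans base_rate_early; rewrite le_eqVlt; apply/orP; left; apply/eqP.
  apply: eq_integral => u; rewrite inE/= in_itv/= => /andP[_ ui].
  by rewrite beta_out ?addr0//; left.
- by rewrite /holder_norm -(eq_holder_seminorm E) -(eq_normL E).
Qed.

End perturbation.

Lemma base_hazard_rate_lower_bound : exists2 c : R, 0 < c &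
  forall u, i1 <= u <= i2 -> c <= base_rate u * g u.
Proof.
(* Writing [u ^ b] as [u ^ (b + 1) / u] bounds it on [[i1, i2]] without a case distinction on the
   sign of [b]. *)
exists (a / (b + 1) * (i1 `^ (b + 1) / i2)) => [|u /andP[u1 u2]].
  by rewrite mulr_gt0 ?divr_gt0 ?powR_gt0// (lt_trans i1_gt0).
have u0 : 0 < u by exact: lt_le_trans u1.
rewrite -base_hazE ?(ltW u0)// (le_trans _ (base_haz_lb u1))// [leRHS]mulrAC.
rewrite ler_wpM2l ?divr_ge0 ?(ltW a_gt0) ?(ltW bp1)//.
have -> : u `^ b = u `^ (b + 1) / u.
  by rewrite powRD ?gt_eqF ?implybT// powRr1 ?(ltW u0)// mulfK// gt_eqF.
rewrite ler_pM ?powR_ge0 ?invr_ge0//.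
- by rewrite (ltW (lt_trans i1_gt0 i12)).
- by rewrite ge0_ler_powR ?(ltW bp1)// nnegrE ltW.
- by rewrite lef_pV2// posrE (lt_trans i1_gt0).
Qed.

(** * The cube of rates, its divergences and its losses *)

Section cells.
Variables (Q : R.-pker T ~> T) (r K : nat) (w G c1 : R).
Hypothesis K_gt0 : (0 < K)%N.
Hypothesis w_gt0 : 0 < w.
Hypothesis G_gt0 : 0 < G.
Hypothesis G_bound : forall u, 0 <= u <= i2 -> g u <= G.
Hypothesis c1_gt0 : 0 < c1.
Hypothesis c1_bound : forall u, i1 <= u <= i2 -> c1 <= base_rate u * g u.
Implicit Types (e : {ffun 'I_K -> bool}) (k : 'I_K).

Let h : R := (i2 - i1) / K%:R.

Let K0 : 0 < K%:R :> R. Proof. by rewrite ltr0n. Qed.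

Let h_gt0 : 0 < h. Proof. by rewrite divr_gt0// subr_gt0. Qed.

Let Kh : i1 + K%:R * h = i2.
Proof. by rewrite /h; field; rewrite gt_eqF. Qed.

Let bumps (e : 'I_K -> bool) : R -> R := cell_bumps r i1 h w e 0.

Let bumps_ge0 (e : 'I_K -> bool) x : 0 <= bumps e x.
Proof. by have /andP[] := @cell_bumps_itv R r K i1 h w e x (ltW w_gt0). Qed.

Let bumps_le (e : 'I_K -> bool) x : bumps e x <= w.
Proof. by have /andP[] := @cell_bumps_itv R r K i1 h w e x (ltW w_gt0). Qed.

Let bumps_continuous (e : 'I_K -> bool) : continuous (bumps e).
Proof. exact: cell_bumps_continuous. Qed.

Let bumps_out (e : 'I_K -> bool) x : x <= i1 \/ i2 <= x -> bumps e x = 0.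
Proof. by move=> xo; apply: cell_bumps_out => //; rewrite Kh. Qed.

Let bumps_notin (e : 'I_K -> bool) x : ~ i1 <= x <= i2 -> bumps e x = 0.
Proof.
move=> x12; apply: bumps_out; have [x1|x1] := leP x i1; first by left.
by right; rewrite leNgt; apply/negP => x2; apply: x12; rewrite !ltW.
Qed.

Definition cell_rate e : R -> R := base_rate \+ bumps e.

Definition cell_hazard e : hazard := @rate_hazard (bumps e) w
  (bumps_ge0 e) (bumps_le e) (@bumps_continuous e).

Definition cell_law e : R -> probability T R := pdf_law (first_jump_pdf (cell_hazard e)).

Lemma cell_prejump_law e : prejump_law phi (cell_rate e) (cell_law e).
Proof. exact: rate_prejump_law. Qed.

Lemma cell_rate_class e :
  holder J alpha (lam0 \+ bumps e) ->
  (holder_norm J alpha (lam0 \+ bumps e)%R <= L%:E)%E ->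
  rate_class phi m M i1 J a l L b alpha (cell_rate e).
Proof. by apply: (@perturbed_rate_class _ w) => // x; exact: bumps_out. Qed.

(** The bump of the cell added twice: this rate realises the auxiliary hazard of [first_jump_ratio].
    Only its first-jump density enters, so its height up to [3 * w] is harmless for the class. *)
Let beta2 e k x := bumps e x + 2 * bumps (pred1 k) x.

Let beta2_ge0 e k x : 0 <= beta2 e k x.
Proof. by rewrite addr_ge0// mulr_ge0. Qed.

Let beta2_le e k x : beta2 e k x <= 3 * w.
Proof.
by have := bumps_le e x; have := bumps_le (pred1 k) x; rewrite /beta2; lra.
Qed.

Let beta2_continuous e k : continuous (beta2 e k).
Proof.
move=> x; apply: cvgD; first exact: bumps_continuous.
by apply: cvgM; [exact: cvg_cst|exact: bumps_continuous].
Qed.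

(** With [v] the bump, the integrand [(v / rate) ^ 2 * (rate * g)] equals
    [v ^ 2 * g ^ 2 / (rate * g)], hence is at most [w ^ 2 * G ^ 2 / c1]; it lives on one cell of
    length [h]. *)
Let rho : R := w ^+ 2 * (G ^+ 2 / c1) * h.

Let rho_ge0 : 0 <= rho.
Proof.
by rewrite mulr_ge0 ?(ltW h_gt0)// mulr_ge0 ?sqr_ge0// divr_ge0 ?sqr_ge0// ltW.
Qed.

Let rate_pos e x : i1 <= x <= i2 -> 0 < cell_rate e x.
Proof.
move=> /[dup] x12 /andP[x1 x2].
have x0 : 0 <= x by rewrite (le_trans (ltW i1_gt0)).
apply: ltr_wpDr => //; have := lt_le_trans c1_gt0 (c1_bound x12).
by rewrite pmulr_lgt0// clock_deriv_gt0.
Qed.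

(** Restricting the denominator to [Rplus] makes it measurable on the line; where it may vanish the
    bump is 0 as well, so the quotient is 0. *)
Let ratio e k x : R := bumps (pred1 k) x / (cell_rate e \_ Rplus) x.

Let ratio_out e k x : ~ i1 <= x <= i2 -> ratio e k x = 0.
Proof.
by move=> x12; rewrite /ratio bumps_notin ?mul0r.
Qed.

Let ratio_in e k x : i1 <= x <= i2 ->
  x \in Rplus /\ ratio e k x = bumps (pred1 k) x / cell_rate e x.
Proof.
move=> /andP[x1 x2]; have x0 : 0 <= x by rewrite (le_trans (ltW i1_gt0)).
by rewrite /ratio patchE mem_set.
Qed.

Let ratio_ge0 e k x : 0 <= ratio e k x.
Proof.
have [x12|x12] := pselect (i1 <= x <= i2); last by rewrite ratio_out.
have [_ ->] := ratio_in e k x12.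
by rewrite divr_ge0// ltW// rate_pos.
Qed.

Let measurable_cell_rate e : measurable_fun setT (cell_rate e \_ Rplus : T -> T).
Proof.
apply/(measurable_restrictT _ _).1; first by rewrite RplusE.
apply: measurable_funD; first exact: measurable_base_rate.
apply: measurable_funTS; exact: continuous_measurable_fun.
Qed.

Let measurable_ratio e k : measurable_fun setT (ratio e k : T -> T).
Proof.
(* On nonnegative reals, 0 included, the inverse agrees with the power [-1], which is a measurable
   function. *)
rewrite (_ : ratio e k = fun x => bumps (pred1 k) x * (cell_rate e \_ Rplus) x `^ (-1)).
  apply: measurable_funM; first exact: continuous_measurable_fun.
  exact: (measurableT_comp (measurable_powR (R := R) (-1)) (measurable_cell_rate e)).
apply/funext => x; rewrite powR_inv1// patchE; case: ifPn => // /set_mem x0.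
by rewrite addr_ge0// base_rate_ge0.
Qed.

Let cell_hazard_flip e k u : e k = false ->
  cell_hazard (flip k e) u = (1 + ratio e k u) * cell_hazard e u.
Proof.
move=> ek; have fe : bumps (flip k e) u = bumps e u + bumps (pred1 k) u.
  apply: cell_bumps_flip => //; first by rewrite ffunE eqxx ek.
  by move=> l' lk; rewrite ffunE (negbTE lk).
rewrite !rate_hazardE fe; have [u12|u12] := pselect (i1 <= u <= i2).
  have [-> ->] := ratio_in e k u12.
  have := rate_pos e u12; rewrite /cell_rate/= => r0.
  by field; rewrite gt_eqF.
by rewrite (ratio_out e k u12) (bumps_notin (pred1 k) u12) !addr0 mul1r.
Qed.

Let rate_hazard2 e k := @rate_hazard (beta2 e k) (3 * w)
  (beta2_ge0 e k) (beta2_le e k) (@beta2_continuous e k).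

Let rate_hazard2E e k u :
  rate_hazard2 e k u = (1 + 2 * ratio e k u) * cell_hazard e u.
Proof.
rewrite !rate_hazardE /beta2; have [u12|u12] := pselect (i1 <= u <= i2).
  have [-> ->] := ratio_in e k u12.
  have := rate_pos e u12; rewrite /cell_rate/= => r0.
  by field; rewrite gt_eqF.
by rewrite (ratio_out e k u12) (bumps_notin (pred1 k) u12) mulr0 !addr0 mul1r.
Qed.

Let chi2_le e k :
  (\int[mu]_u (ratio e k u ^+ 2 * cell_hazard e u)%:E <= rho%:E)%E.
Proof.
pose D : set T := `[i1 + k%:R * h, i1 + k.+1%:R * h]%classic.
have mD : (mu D = h%:E)%E.
  rewrite lebesgue_measure_itv/= lte_fin ltrD2l ltr_pM2r// ltr_nat ltnSn.
  by rewrite -EFinD; congr EFin; rewrite -natr1; ring.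
have -> : (rho%:E = \int[mu]_(u in D) (w ^+ 2 * (G ^+ 2 / c1))%:E)%E.
  by rewrite integral_cst; [rewrite [X in (_ * X)%E]mD|exact: measurable_itv].
rewrite [leRHS]integral_mkcond; apply: le_integral_ge0 => u _.
  by rewrite lee_fin mulr_ge0 ?sqr_ge0 ?hazard_ge0.
rewrite patchE; case: ifPn => [_|uD]; last first.
  rewrite lee_fin /ratio /bumps cell_bump_out//; first by rewrite mul0r expr0n mul0r.
  move: uD; rewrite notin_setE /D /= in_itv/= => /negP; rewrite negb_and -!ltNge.
  by move=> /orP[/ltW|/ltW]; [left|right].
have [u12|u12] := pselect (i1 <= u <= i2); last first.
  rewrite ratio_out// expr0n mul0r lee_fin mulr_ge0 ?sqr_ge0//.
  by rewrite divr_ge0 ?sqr_ge0// ltW.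
have [uR ->] := ratio_in e k u12.
rewrite lee_fin rate_hazardE uR.
have rp := rate_pos e u12; have bu := bumps_le (pred1 k) u.
have bu0 := bumps_ge0 (pred1 k) u.
have u0 : 0 <= u by exact: set_mem uR.
have g0 := clock_deriv_gt0 u0.
have gG : g u <= G by apply: G_bound; move: u12 => /andP[_ ->]; rewrite u0.
have rg : c1 <= cell_rate e u * g u.
  rewrite (le_trans (c1_bound u12))// ler_wpM2r ?(ltW g0)//.
  by rewrite /cell_rate/= lerDl.
rewrite (_ : base_rate u + bumps e u = cell_rate e u)//.
move: (cell_rate e u) (g u) (bumps _ u) rp bu bu0 g0 gG rg => x y z xp zw z0 y0 yG xy.
have -> : (z / x) ^+ 2 * (x * y) = z ^+ 2 * (y ^+ 2 / (x * y)).
  by field; rewrite !gt_eqF.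
rewrite ler_pM ?sqr_ge0 ?divr_ge0 ?mulr_ge0 ?(ltW xp) ?(ltW y0)//.
  by rewrite lerXn2r ?nnegrE// (le_trans z0).
rewrite ler_pM ?sqr_ge0 ?invr_ge0 ?mulr_ge0 ?(ltW xp) ?(ltW y0)//.
  by rewrite lerXn2r ?nnegrE ?(ltW y0)// ltW.
by rewrite lef_pV2// posrE (lt_le_trans c1_gt0).
Qed.

Let pair_risk n (z c : R) e k (F0 F1 : n.-tuple (T * T) -> \bar R) :
  e k = false -> 0 <= c -> (1 + rho) ^+ n <= 2 ->
  measurable_fun setT F0 -> (forall s, 0 <= F0 s)%E ->
  measurable_fun setT F1 -> (forall s, 0 <= F1 s)%E ->
  (forall s, c%:E <= F0 s + F1 s)%E ->
  ((c / 2)%:E <= chain_expectation (cell_law e) Q z F0 +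
                 chain_expectation (cell_law (flip k e)) Q z F1)%E.
Proof.
move=> ek c0 rn mF0 F00 mF1 F10 F01.
have := @two_point_risk R (cell_hazard e) (cell_hazard (flip k e)) (rate_hazard2 e k)
  (ratio e k) rho Q (ratio_ge0 e k) (@measurable_ratio e k)
  (fun u => cell_hazard_flip u ek) (rate_hazard2E e k) rho_ge0 (chi2_le e k)
  n z 1 c F0 F1 ler01 c0 mF0 F00 mF1 F10 F01.
rewrite mul1e mulr1 expr1n mulr1 -/(cell_law e) -/(cell_law (flip k e)).
(* At the start the weight is 1, and [(1 + rho) ^ n <= 2] leaves [c - c / 2] of the bound. *)
have : ((c * (1 + rho) ^+ n / 4)%:E <= (c / 2)%:E)%E by rewrite lee_fin; nra.
have : (0 <= chain_expectation (cell_law e) Q z F0)%E by exact: chain_expectation_ge0.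
have : (0 <= chain_expectation (cell_law (flip k e)) Q z F1)%E.
  exact: chain_expectation_ge0.
move: (chain_expectation _ _ _ F0) (chain_expectation _ _ _ F1) => x y y0 x0 q2 H.
have {}H : (c%:E <= x + y + (c / 2)%:E)%E by apply: (le_trans H); exact: leeD2l.
rewrite -(@leeD2rE _ (c / 2)%:E)// -EFinD.
by rewrite (_ : c / 2 + c / 2 = c)%R//; field.
Qed.

Section estimator.
Variables (n : nat) (z0 : R) (est : R * n.-tuple (R * R) -> R -> R).
Hypothesis est_measurable : is_estimator est.
Hypothesis rho_small : (1 + w ^+ 2 * (G ^+ 2 / c1) * ((i2 - i1) / K%:R)) ^+ n <= 2.

(** The core lies in [Rplus], so the restriction changes nothing there and yields a jointly
    measurable integrand. *)
Let loss e k (s : n.-tuple (T * T)) (x : R) : R :=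
  (est (z0, s) x - (cell_rate e \_ Rplus) x) ^+ 2 * \1_(cell_core i1 h k) x.

Let loss_ge0 e k s x : 0 <= loss e k s x.
Proof. by rewrite mulr_ge0 ?sqr_ge0. Qed.

Let measurable_loss e k :
  measurable_fun setT (fun p : n.-tuple (T * T) * T => loss e k p.1 p.2 : T).
Proof.
have m1 : measurable_fun setT (fun p : n.-tuple (T * T) * T => est (z0, p.1) p.2 : T).
  apply: (measurableT_comp est_measurable
    (g := fun p : n.-tuple (T * T) * T => ((z0 : T, p.1), p.2))).
  by apply: measurable_fun_pair => //; apply: measurable_fun_pair.
have m2 : measurable_fun setT
    (fun p : n.-tuple (T * T) * T => (cell_rate e \_ Rplus) p.2 : T).
  exact: (measurableT_comp (measurable_cell_rate e)).
have m3 : measurable_fun setT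
    (fun p : n.-tuple (T * T) * T => \1_(cell_core i1 h k) p.2 : T).
  apply: (measurableT_comp (f := (\1_(cell_core i1 h k) : T -> T))) => //.
  by apply: measurable_indic; exact: measurable_itv.
by apply: measurable_funM => //; apply: measurable_funX; exact: measurable_funB.
Qed.

Let cell_loss e k (s : n.-tuple (T * T)) : \bar R :=
  (\int[mu]_x (loss e k s x)%:E)%E.

Let cell_loss_ge0 e k s : (0 <= cell_loss e k s)%E.
Proof. by apply: integral_ge0 => x _; rewrite lee_fin. Qed.

Let measurable_cell_loss e k : measurable_fun setT (cell_loss e k).
Proof.
apply: (@measurable_fun_fubini_tonelli_F _ _ _ T R mu
  (fun p : n.-tuple (T * T) * T => (loss e k p.1 p.2)%:E)).
- by apply/measurable_EFinP; exact: measurable_loss.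
- by move=> p; rewrite lee_fin.
Qed.

Let measurable_loss2 e k s : measurable_fun setT (fun x : T => (loss e k s x)%:E).
Proof.
apply/measurable_EFinP.
exact: (measurableT_comp (measurable_loss e k) (@measurable_pair1 _ _ _ T s)).
Qed.

(** The core has length [h / 2], and the squared distances from any number to two numbers at least
    [d] apart add up to at least [d ^ 2 / 2]. *)
Let c0 : R := h / 4 * (w * (3 / 16) ^+ r.+1) ^+ 2.

Let c0_ge0 : 0 <= c0.
Proof. by rewrite mulr_ge0 ?sqr_ge0// divr_ge0// ltW. Qed.

Let cell_loss_pair e k s : e k = false ->
  (c0%:E <= cell_loss e k s + cell_loss (flip k e) k s)%E.
Proof.
move=> ek; rewrite /cell_loss -ge0_integralD//; last 2 first.
- by move=> x _; rewrite lee_fin.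
- by move=> x _; rewrite lee_fin.
pose d := w * (3 / 16) ^+ r.+1.
have d0 : 0 <= d by rewrite mulr_ge0 ?(ltW w_gt0)// exprn_ge0.
have mcore : (mu (cell_core i1 h k) = (h / 2)%:E)%E.
  rewrite lebesgue_measure_itv/= lte_fin ltrD2l ltr_pM2r// ltrD2l ifT; last lra.
  by rewrite -EFinD; congr EFin; field.
have -> : (c0%:E = \int[mu]_(x in cell_core i1 h k) (d ^+ 2 / 2)%:E)%E.
  rewrite integral_cst; last exact: measurable_itv.
  by rewrite [X in (_ * X)%E]mcore -EFinM; congr EFin; rewrite /c0 -/d; field.
rewrite [leLHS]integral_mkcond; apply: le_integral_ge0 => x _.
  by apply: erestrict_ge0 => y _; rewrite lee_fin divr_ge0 ?sqr_ge0.
rewrite patchE -EFinD; case: ifPn => xc; last by rewrite lee_fin addr_ge0.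
rewrite lee_fin /loss indicE xc !mulr1.
have xI : i1 <= x <= i2.
  by have := cell_core_sub h_gt0 (set_mem xc); rewrite /= in_itv/= Kh.
have x0 : 0 <= x by move: xI => /andP[x1 _]; exact: le_trans (ltW i1_gt0) x1.
rewrite !patchE mem_set//.
have -> : cell_rate (flip k e) x = cell_rate e x + bumps (pred1 k) x.
  rewrite /cell_rate/= -addrA; congr (_ + _); apply: cell_bumps_flip => //.
    by rewrite ffunE eqxx ek.
  by move=> l' lk; rewrite ffunE (negbTE lk).
have : d <= bumps (pred1 k) x.
  apply: cell_bump_ge => //; first exact: ltW.
  by have := set_mem xc; rewrite /cell_core /= in_itv.
move: (est _ _) (cell_rate e x) (bumps _ x) => t u v dv.
rewrite -subr_ge0 (_ : _ - _ = (2 * (t - u) - v) ^+ 2 / 2 + (v ^+ 2 - d ^+ 2) / 2).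
  rewrite addr_ge0 ?divr_ge0 ?sqr_ge0// subr_ge0 lerXn2r// nnegrE.
  exact: le_trans dv.
by field.
Qed.

Let sum_cell_loss e s : (\sum_k cell_loss e k s <=
  normL `[i1, i2] 2 (EFin \o (est (z0, s) \- cell_rate e)%R) ^+ 2)%E.
Proof.
rewrite normL2_sqr /cell_loss -ge0_integral_sum//; last first.
  by move=> k x _; rewrite lee_fin.
rewrite [leRHS]integral_mkcond; apply: le_integral_ge0 => x _.
  by apply: sume_ge0 => k _; rewrite lee_fin.
rewrite sumEFin /loss -mulr_sumr [leRHS]patchE.
have S := @sum_cell_core R K i1 h h_gt0 x; rewrite Kh indicE in S.
case: ifPn => xI; rewrite ?xI ?(negbTE xI) in S; last first.
  rewrite lee_fin -[leRHS](mulr0 ((est (z0, s) x - (cell_rate e \_ Rplus) x) ^+ 2)).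
  by rewrite ler_wpM2l ?sqr_ge0.
have x0 : 0 <= x.
  by have := set_mem xI; rewrite /= in_itv/= => /andP[x1 _]; exact: le_trans (ltW i1_gt0) x1.
by rewrite lee_fin patchE (mem_set (A := Rplus))// ler_piMr ?sqr_ge0.
Qed.

Lemma cell_minimax (V : \bar R) :
  (forall e, risk i1 i2 z0 (cell_law e) Q est (cell_rate e) <= V)%E ->
  ((K%:R * (c0 / 2 / 2))%:E <= V)%E.
Proof.
move=> HV; apply: (@assouad R K (c0 / 2) V
  (fun e k => chain_expectation (cell_law e) Q z0 (cell_loss e k))).
- by move=> e k; exact: chain_expectation_ge0.
- move=> e; apply: le_trans (HV e); rewrite /risk.
  apply: (@le_trans _ _ (chain_expectation (cell_law e) Q z0
    (fun s => \sum_k cell_loss e k s)%E)).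
    apply: chain_expectation_sum => //; exact: measurable_first_jump.
  apply: le_chain_expectation => s; last exact: sum_cell_loss.
  by apply: sume_ge0.
(* [pair_risk] takes the lower rate first; when the bump of cell [k] is present in [e], the roles of
   [e] and [flip k e] are exchanged. *)
move=> e k; have [ek|ek] := boolP (e k).
  have fk : flip k e k = false by rewrite ffunE eqxx ek.
  have fe : flip k (flip k e) = e.
    by apply/ffunP => l'; rewrite !ffunE; case: eqP => // _; rewrite negbK.
  rewrite addeC -{3 4}fe; apply: pair_risk => // s; exact: cell_loss_pair.
by apply: pair_risk => //; [exact: negbTE|move=> s; exact/cell_loss_pair/negbTE].
Qed.

End estimator.

End cells.

End rates.

(** * The lower bound *)

(** The product [(1 + rho) ^ j * (1 - j * rho)] starts at 1 and does not increase with [j], because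
    [(1 + rho) * (1 - (j + 1) * rho) <= 1 - j * rho]. *)
Lemma expr1D_le2 (R : realFieldType) (rho : R) n :
  0 <= rho -> n%:R * rho <= 2^-1 -> (1 + rho) ^+ n <= 2.
Proof.
move=> r0 nr.
have H j : (1 + rho) ^+ j * (1 - j%:R * rho) <= 1.
  elim: j => [|j IH]; first by rewrite expr0 mul0r subr0 mul1r.
  apply: le_trans IH; rewrite exprSr -mulrA ler_wpM2l ?exprn_ge0 ?addr_ge0//.
  rewrite -subr_ge0 -natr1 (_ : _ - _ = (j%:R + 1) * rho ^+ 2); last by ring.
  by rewrite mulr_ge0 ?sqr_ge0// addr_ge0.
have H2 : 2^-1 <= 1 - n%:R * rho by lra.
have := H n; have : 0 <= (1 + rho) ^+ n by rewrite exprn_ge0// addr_ge0.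
move: ((1 + rho) ^+ n) (1 - n%:R * rho) H2 => x y; nra.
Qed.

(* With about [n ^ (1 / (2 alpha + 1))] cells, the chi-square divergence per
   jump between neighbouring hypotheses is of order [1 / n]. *)
Lemma cell_number (R : realType) (alpha ell A chi q : R) :
  0 < alpha -> 0 < ell -> 0 < A -> 0 < chi -> 0 < q ->
  exists2 C : R, 0 < C & forall n, (0 < n)%N -> exists2 K : nat, (0 < K)%N &
    let h := ell / K%:R in
    (1 + (A * h `^ alpha) ^+ 2 * chi * h) ^+ n <= 2 /\
    C * n%:R `^ (- (2 * alpha / (2 * alpha + 1))) <=
      K%:R * (h / 4 * (A * h `^ alpha * q) ^+ 2 / 2 / 2).
Proof.
move=> a0 l0 A0 chi0 q0.
have g0 : 0 < 2 * alpha + 1 by rewrite addr_gt0// mulr_gt0.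
pose Q0 := A ^+ 2 * chi * ell `^ (2 * alpha + 1).
have Q00 : 0 < Q0 by rewrite mulr_gt0 ?powR_gt0// mulr_gt0// exprn_gt0.
(* The divergence per jump is [Q0 * K ^ (- (2 * alpha + 1))]; with this [B], any [K >= B * nu] makes
   [n] times it at most [2^-1]. *)
pose B := (2 * Q0) `^ (2 * alpha + 1)^-1.
have B0 : 0 < B by rewrite powR_gt0// mulr_gt0.
have powR_sqr (x : R) : 0 <= x -> (x `^ alpha) ^+ 2 = x `^ (2 * alpha).
  by move=> x0; rewrite -powR_mulrn ?powR_ge0// -powRrM mulrC.
exists (ell / 16 * q ^+ 2 * A ^+ 2 * ell `^ (2 * alpha) * (B + 1) `^ (- (2 * alpha))).
  by rewrite !mulr_gt0 ?powR_gt0 ?exprn_gt0 ?addr_gt0// invr_gt0.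
move=> n n0; have n0' : 0 < n%:R :> R by rewrite ltr0n.
pose nu := n%:R `^ (2 * alpha + 1)^-1 : R.
(* This absorbs the rounding in [K]: [B * nu + 1 <= (B + 1) * nu], the origin of [B + 1] in the
   constant. *)
have nu1 : 1 <= nu.
  by rewrite -(powRr0 n%:R) ler_powR ?ler1n// invr_ge0 ltW.
have nu0 : 0 < nu by exact: lt_le_trans nu1.
have nuE : nu `^ (2 * alpha + 1) = n%:R.
  by rewrite /nu -powRrM mulVf ?gt_eqF// powRr1// ltW.
have BE : B `^ (2 * alpha + 1) = 2 * Q0.
  by rewrite /B -powRrM mulVf ?gt_eqF// powRr1// ltW// mulr_gt0.
pose K := (Num.truncn (B * nu)).+1.
exists K => // h.
have K0 : 0 < K%:R :> R by rewrite ltr0n.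
have h0 : 0 < h by rewrite divr_gt0.
have Kge : B * nu <= K%:R by exact/ltW/truncnS_gt.
have Kle : K%:R <= (B + 1) * nu.
  rewrite /K -natr1 mulrDl mul1r lerD//.
  by rewrite truncn_le mulr_ge0 ?ltW.
have hE (x : R) : h `^ x = ell `^ x * K%:R `^ (- x).
  by rewrite /h powRM ?invr_ge0 ?ltW// -powR_inv1 ?ltW// -powRrM mulN1r.
split.
  apply: expr1D_le2.
    by apply: mulr_ge0 (ltW h0); apply: mulr_ge0 (ltW chi0); exact: sqr_ge0.
  rewrite exprMn powR_sqr ?(ltW h0)//.
  have -> : A ^+ 2 * h `^ (2 * alpha) * chi * h = A ^+ 2 * chi * h `^ (2 * alpha + 1).
    rewrite [h `^ (_ + 1)]powRD ?(gt_eqF h0) ?implybT// powRr1 ?(ltW h0)//.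
    by ring.
  rewrite hE mulrA -/Q0 powRN.
  have KQ : 2 * Q0 * n%:R <= K%:R `^ (2 * alpha + 1).
    have -> : 2 * Q0 * n%:R = (B * nu) `^ (2 * alpha + 1).
      by rewrite powRM ?(ltW B0) ?(ltW nu0)// BE nuE.
    apply: ge0_ler_powR => //; rewrite ?nnegrE ?(ltW g0) ?(ltW K0)//.
    exact: mulr_ge0 (ltW B0) (ltW nu0).
  rewrite mulrA ler_pdivrMr ?powR_gt0// (_ : n%:R * Q0 = 2^-1 * (2 * Q0 * n%:R)).
    by rewrite ler_wpM2l// invr_ge0.
  by field.
have -> : K%:R * (h / 4 * (A * h `^ alpha * q) ^+ 2 / 2 / 2) =
    ell / 16 * q ^+ 2 * A ^+ 2 * ell `^ (2 * alpha) * K%:R `^ (- (2 * alpha)).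
  rewrite !exprMn powR_sqr ?(ltW h0)// hE /h.
  by move: (ell `^ _) (K%:R `^ _) => x y; field; rewrite gt_eqF.
rewrite -mulrA; apply: ler_wpM2l.
  apply: mulr_ge0; last exact: powR_ge0.
  apply: mulr_ge0; last exact: sqr_ge0.
  by apply: mulr_ge0; [rewrite divr_ge0// ltW|exact: sqr_ge0].
have -> : n%:R `^ (- (2 * alpha / (2 * alpha + 1))) = nu `^ (- (2 * alpha)).
  by rewrite /nu -powRrM; congr (_ `^ _); ring.
have B10 : 0 < B + 1 by rewrite addr_gt0.
have Bnu : 0 < (B + 1) * nu by exact: mulr_gt0.
rewrite -powRM ?(ltW nu0) ?(ltW B10)// !powRN lef_pV2 ?posrE ?powR_gt0//.
apply: ge0_ler_powR => //; rewrite ?nnegrE ?(ltW K0) ?(ltW Bnu)//.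
by apply: mulr_ge0 => //; exact: ltW.
Qed.

Lemma holder_norm_ge0 (R : realType) (A : set R) (beta : R) (f : R -> R) :
  A !=set0 -> (0 <= holder_norm A beta f)%E.
Proof. by move=> A0; rewrite adde_ge0 ?holder_seminorm_ge0 ?Lnorm_ge0. Qed.

Lemma holder_bounded (R : realType) (c alpha : R) (f : R -> R) :
  (forall d, c < d -> holder `[c, d] alpha f) ->
  forall y, exists C : R, forall u, c <= u <= y -> f u <= C.
Proof.
move=> fH y.
have [|/Cr_continuous fc _] := fH (Num.max y (c + 1)).
  by rewrite lt_max ltrDl ltr01 orbT.
have cd : c <= Num.max y (c + 1) by rewrite le_max lerDl ler01 orbT.
have [x _ xM] := EVT_max cd fc; exists (f x) => u /andP[cu uy].
by apply: xM; rewrite in_itv/= cu le_max uy.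
Qed.

Theorem theorem10 (R : realType) (i1 i2 z0 : R)
    (phi : R -> R -> R) (lam : R -> R)
    (Q : R.-pker (measurableTypeR R) ~> (measurableTypeR R))
    (kappa a b l L alpha : R) (m M : R -> R)
    (Q1 : R -> R -> R) (jQ : nat) (p f : nat -> R -> R)
    (S : nat -> set (R -> R)) (D : nat -> nat)
    (J := Jfinal i1 i2 kappa a b alpha jQ f)
    (E := rate_class phi m M i1 J a l L b alpha) :
  0 < i1 -> i1 < i2 -> 0 <= z0 ->
  is_flow phi -> is_jump_rate phi lam -> is_transition Q ->
  condS1 phi lam Q z0 kappa ->
  condS2 phi m M ->
  condS3 i1 a b m lam ->
  condS4 i1 i2 kappa a b l L M lam ->
  condS6 phi lam Q alpha Q1 p jQ f ->
  model_conditions i1 i2 S D ->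
  slack_class phi m M i1 J a l L b alpha ->
  exists2 C : R, 0 < C & forall n : nat, (0 < n)%N ->
    ((C * n%:R `^ (- (2 * alpha / (2 * alpha + 1))))%:E
     <= minimax_risk i1 i2 z0 phi Q E n)%E.
Proof.
move=> i1_gt0 i12 _ phiP lamP _ _ mM [_ a_gt0 b_gtN1 lam_lb] _.
move=> [alpha_gt0 [_ lamH _ _ _]] _ [lam0 [lam0P [lam0H lam0_lb lam0_early _]] lam0_norm].
have Ji1 : J i1 by apply: Jfinal_sub; rewrite /= in_itv/= lexx ltW.
have J0 : J !=set0 by exists i1.
have mJ : measurable (J : set (measurableTypeR R)) by exact: measurable_Jfinal.
have Jthick : thick J by exact: Jfinal_thick.
have lam_bd : forall y, exists C : R, forall u, i1 <= u <= y -> lam u <= C.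
  by apply: (@holder_bounded _ _ alpha) => d; exact: lamH.
have lam0_bd : (normL J +oo (EFin \o lam0) < +oo)%E.
  apply: le_lt_trans (lt_trans lam0_norm (ltry L)).
  by rewrite leeDr// holder_seminorm_ge0.
pose s := fine (holder_norm J alpha lam0).
have lam0_normE : holder_norm J alpha lam0 = s%:E.
  by rewrite fineK// ge0_fin_numE ?holder_norm_ge0// (lt_trans lam0_norm) ?ltry.
have sL : s < L by rewrite -lte_fin -lam0_normE.
have [Ch Ch_gt0 perturb] := perturbed_holder_norm alpha_gt0.
have [G G_gt0 G_bound] := clock_deriv_bounded phiP mM i2.
have [c1 c1_gt0 c1_bound] := base_hazard_rate_lower_bound J
  i1_gt0 i12 phiP mM a_gt0 b_gtN1 lamP lam_lb lam0P lam0_lb.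
have ell_gt0 : 0 < i2 - i1 by rewrite subr_gt0.
(* Since [h <= i2 - i1], the perturbation raises the norm by at most
   [A * (Ch + (i2 - i1) ^ alpha) = L - s], exactly the slack, for every number of cells. *)
pose A := (L - s) / (Ch + (i2 - i1) `^ alpha).
have Ch_ell : 0 < Ch + (i2 - i1) `^ alpha by rewrite addr_gt0// powR_gt0.
have A_gt0 : 0 < A by rewrite divr_gt0// subr_gt0.
pose r := Num.truncn alpha.
have [||C C_gt0 cells] := @cell_number R alpha (i2 - i1) A (G ^+ 2 / c1)
  ((3 / 16) ^+ r.+1) alpha_gt0 ell_gt0 A_gt0.
- by rewrite divr_gt0// exprn_gt0.
- by rewrite exprn_gt0// divr_gt0.
exists C => // n n_gt0.
have [K K_gt0] := cells n n_gt0; set h := _ / K%:R => -[chi2_small CK].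
have h_gt0 : 0 < h by rewrite divr_gt0// ltr0n.
have w_gt0 : 0 < A * h `^ alpha by rewrite mulr_gt0// powR_gt0.
have rate_in_class (e : {ffun 'I_K -> bool}) :
    E (cell_rate i1 i2 J lam0 lam r (A * h `^ alpha) e).
  have [betaH beta_norm] :=
    perturb J lam0 K i1 h A e Jthick J0 h_gt0 (ltW A_gt0) lam0H.
  apply: (cell_rate_class i1_gt0 i12 phiP mM) => //.
  apply: le_trans beta_norm _.
  rewrite lam0_normE -EFinD lee_fin -lerBrDl -mulrDr.
  rewrite /A mulrAC ler_pdivrMr// ler_wpM2l ?subr_ge0 ?(ltW sL)// lerD2l.
  apply: ge0_ler_powR => //; rewrite ?nnegrE ?(ltW alpha_gt0) ?(ltW h_gt0) ?(ltW ell_gt0)//.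
  by rewrite ler_pdivrMr ?ltr0n// ler_peMr ?(ltW ell_gt0)// ler1n.
apply: le_ereal_inf_tmp => _ [est est_measurable <-].
apply: (@le_trans _ _ (K%:R * (h / 4 * (A * h `^ alpha * (3 / 16) ^+ r.+1) ^+ 2 / 2 / 2))%:E).
  by rewrite lee_fin.
apply: (@cell_minimax R phi m M i1 i2 a b l J lam0 lam i1_gt0 i12 phiP mM a_gt0
  b_gtN1 lamP lam_lb lam_bd lam0P lam0_lb lam0_early lam0_bd Ji1 mJ Q r K
  (A * h `^ alpha) G c1 K_gt0 w_gt0 G_gt0 G_bound c1_gt0 c1_bound n z0 est
  est_measurable chi2_small) => e.
apply: ereal_sup_ubound; exists (cell_rate i1 i2 J lam0 lam r (A * h `^ alpha) e).
by eexists; split; last by []; [exact: rate_in_class|exact: cell_prejump_law].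
Qed.
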